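(* The preorder of almost inclusion $\subseteq^*$ among quadratic-time computable languages (as a relation on indices in a standard effective listing of the class $\mathrm{DTIME}(n^2)$ via clocked multitape Turing machines) is a $\Sigma^0_2$-complete preorder.
   Context: $X\subseteq^*Y$ means $X\setminus Y$ is finite. A preorder $P$ is $\Sigma^0_2$-complete if it is $\Sigma^0_2$ and for every $\Sigma^0_2$ preorder $Q$ on $\omega$ there is a computable $f$ with $\langle x,y\rangle\in Q\iff\langle f(x),f(y)\rangle\in P$ for all $x,y$. *)

(* Defs.v *)
From mathcomp Require Import all_boot.
From mathcomp Require Import boolp classical_sets cardinality.
From Stdlib Require Import RelationClasses.

Set Implicit Arguments.
Unset Strict Implicit.
Unset Printing Implicit Defensive.

Local Open Scope classical_set_scope.
Local Open Scope nat_scope.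

Inductive recfun : nat -> Type :=
| RZero n : recfun n
| RSucc : recfun 1
| RProj n (i : 'I_n) : recfun n
| RComp m n (f : recfun m) (g : 'I_m -> recfun n) : recfun n
| RPrec n (f : recfun n) (g : recfun n.+2) : recfun n.+1
| RMin n (f : recfun n.+1) : recfun n.

(** [rec_graph c xs y]: the partial function with program [c] is defined at
    [xs], with value [y].  In the [RPrec] case the arguments are the recursion
    variable followed by the parameters, and [h] lists the successive values
    h 0 = f ps and h i.+1 = g (i, h i, ps).  In the [RMin] case, [y] is the
    least zero of f (_, xs), all earlier values being defined. *)
Fixpoint rec_graph n (c : recfun n) : n.-tuple nat -> nat -> Prop :=
  match c in recfun n return n.-tuple nat -> nat -> Prop with
  | RZero _ => fun _ y => y = 0
  | RSucc => fun xs y => y = (thead xs).+1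
  | RProj _ i => fun xs y => y = tnth xs i
  | RComp m _ f g => fun xs y =>
      exists ys : m.-tuple nat,
        (forall i, rec_graph (g i) xs (tnth ys i)) /\ rec_graph f ys y
  | RPrec n f g => fun xs y =>
      let ps : n.-tuple nat := [tuple of behead xs] in
      exists h : nat -> nat,
        [/\ rec_graph f ps (h 0),
            forall i, i < thead xs ->
              rec_graph g [tuple of i :: h i :: ps] (h i.+1)
          & y = h (thead xs)]
  | RMin n f => fun xs y =>
      rec_graph f [tuple of y :: xs] 0 /\
      forall z, z < y -> exists v, rec_graph f [tuple of z :: xs] v.+1
  end.

Lemma rec_graph_fun n (c : recfun n) xs y z :
  rec_graph c xs y -> rec_graph c xs z -> y = z.
Proof.
elim: c xs y z => {n} [n||n i|m n f IHf g IHg|n f IHf g IHg|n f IHf] xs y z /=.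
- by move=> -> ->.
- by move=> -> ->.
- by move=> -> ->.
- move=> [ys [gys fy]] [zs [gzs fz]].
  have eyz : ys = zs by apply: eq_from_tnth => i; apply: IHg (gys i) (gzs i).
  by rewrite -eyz in fz; apply: IHf fy fz.
- move=> [h [h0 hS ->]] [k [k0 kS ->]].
  have E i : i <= thead xs -> h i = k i.
    elim: i => [|i IHi] le_i; first exact: IHf h0 k0.
    by apply: IHg (hS i le_i) _; rewrite (IHi (ltnW le_i)); apply: kS.
  exact: E.
- move=> [fy miny] [fz minz]; case: (ltngtP y z) => // [/minz|/miny] [v fv].
  + by have := IHf _ _ _ fy fv.
  + by have := IHf _ _ _ fz fv.
Qed.

Definition computable n (f : n.-tuple nat -> nat) : Prop :=
  exists c : recfun n, forall xs, rec_graph c xs (f xs).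

Definition computable1 (f : nat -> nat) : Prop :=
  computable (fun xs : 1.-tuple nat => f (thead xs)).

Definition computable_pred n (R : n.-tuple nat -> bool) : Prop :=
  computable (fun xs => nat_of_bool (R xs)).

Definition Sigma02 (P : nat -> nat -> Prop) : Prop :=
  exists2 R : 4.-tuple nat -> bool, computable_pred R &
    forall x y, P x y <-> exists s, forall t, R [tuple x; y; s; t].

Definition Sigma02_complete_preorder (P : nat -> nat -> Prop) : Prop :=
  [/\ PreOrder P, Sigma02 P &
      forall Q : nat -> nat -> Prop, PreOrder Q -> Sigma02 Q ->
        exists2 f : nat -> nat, computable1 f &
          forall x y, Q x y <-> P (f x) (f y)].

Inductive direction := Left | Stay | Right.

(** What a rule does on one tape: the symbol it requires under the head, the
    symbol it writes there, and the subsequent move.  Tape symbols are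
    numbers: 0 is the blank, 1 and 2 are the input letters; besides these, a
    machine only uses the finitely many symbols that occur in its rules. *)
Record action := Action { reads : nat; writes : nat; moves : direction }.

(** From state [source], if each head reads the symbol required by the
    corresponding action (one per tape), perform the actions and go to state
    [target]. *)
Record rule := Rule { source : nat; target : nat; actions : seq action }.

(** The machine has the input tape and [work_tapes] further tapes.  The list of
    rules is a finite partial transition function: the first applicable rule is
    used (so the machine is deterministic), and the machine halts when no rule
    is applicable. *)
Record machine := Machine { work_tapes : nat; rules : seq rule }.

(** A two-way infinite tape: the cells to the left of the head (nearest first),
    the scanned cell, the cells to the right; all other cells are blank. *)
Record tape := Tape { lcells : seq nat; scanned : nat; rcells : seq nat }.

Record config := Config { state : nat; tapes : seq tape }.

Definition act (a : action) (t : tape) : tape :=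
  let: Tape l _ r := t in
  let s := writes a in
  match moves a with
  | Left => Tape (behead l) (head 0 l) (s :: r)
  | Stay => Tape l s r
  | Right => Tape (s :: l) (head 0 r) (behead r)
  end.

Definition applicable (c : config) (r : rule) : bool :=
  (source r == state c) && (map reads (actions r) == map scanned (tapes c)).

Definition apply_rule (r : rule) (c : config) : config :=
  Config (target r) [seq act p.1 p.2 | p <- zip (actions r) (tapes c)].

Definition halted (M : machine) (c : config) : bool :=
  ~~ has (applicable c) (rules M).

Definition step (M : machine) (c : config) : config :=
  if [seq r <- rules M | applicable c r] is r :: _ then apply_rule r c else c.

Definition word := seq bool.

Definition blank_tape : tape := Tape [::] 0 [::].

Definition input_tape (w : word) : tape :=
  let s := [seq (nat_of_bool b).+1 | b <- w] in Tape [::] (head 0 s) (behead s).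

Definition init (M : machine) (w : word) : config :=
  Config 0 (input_tape w :: nseq (work_tapes M) blank_tape).

Definition run (M : machine) (w : word) (T : nat) : config :=
  iter T (step M) (init M w).

Definition halts_within (M : machine) (w : word) (T : nat) : bool :=
  halted M (run M w T).

(** The initial state is 0, and the accepting state is 1. *)
Definition accepts_within (M : machine) (w : word) (T : nat) : bool :=
  halts_within M w T && (state (run M w T) == 1).

Definition quad_bound (c n : nat) : nat := c * (n ^ 2 + 1).

Definition DTIME_quadratic : set (set word) :=
  [set L | exists M c, forall w,
     halts_within M w (quad_bound c (size w)) /\
     (L w <-> accepts_within M w (quad_bound c (size w)))].

(** A machine [M] with a clock of constant [c]: the computation is cut off, and
    the input rejected, after c(n^2+1) steps. *)
Definition clocked_lang (M : machine) (c : nat) : set word :=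
  [set w | accepts_within M w (quad_bound c (size w))].

(** Every number codes a pair of a clock constant and a machine, through the
    computable bijection [CodeSeq.decode : nat -> seq nat]. *)
Definition decode_direction (n : nat) : direction :=
  match n with 0 => Left | 1 => Stay | _ => Right end.

Definition decode_action (n : nat) : action :=
  let s := CodeSeq.decode n in
  Action (nth 0 s 0) (nth 0 s 1) (decode_direction (nth 0 s 2)).

Definition decode_rule (n : nat) : rule :=
  let s := CodeSeq.decode n in
  Rule (nth 0 s 0) (nth 0 s 1) (map decode_action (drop 2 s)).

Definition decode_clocked (n : nat) : nat * machine :=
  let s := CodeSeq.decode n in
  (nth 0 s 0, Machine (nth 0 s 1) (map decode_rule (drop 2 s))).

Definition quad_lang (e : nat) : set word :=
  let: (c, M) := decode_clocked e in clocked_lang M c.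

Lemma map_surj (A B : Type) (f : A -> B) :
  (forall b, exists a, f a = b) -> forall s, exists s', map f s' = s.
Proof.
move=> fs; elim=> [|b s [s' <-]]; first by exists [::].
by have [a <-] := fs b; exists (a :: s').
Qed.

Lemma decode_clocked_surj c M : exists e, decode_clocked e = (c, M).
Proof.
have dir_surj d : exists n, decode_direction n = d.
  by case: d; [exists 0 | exists 1 | exists 2].
have act_surj a : exists n, decode_action n = a.
  case: a => r w d; have [n <-] := dir_surj d.
  by exists (CodeSeq.code [:: r; w; n]); rewrite /decode_action CodeSeq.codeK.
have rule_surj r : exists n, decode_rule n = r.
  case: r => p q s; have [s' <-] := map_surj act_surj s.
  exists (CodeSeq.code [:: p, q & s']).
  by rewrite /decode_rule CodeSeq.codeK /= drop0.
case: M => k s; have [s' <-] := map_surj rule_surj s.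
exists (CodeSeq.code [:: c, k & s']).
by rewrite /decode_clocked CodeSeq.codeK /= drop0.
Qed.

Lemma DTIME_quadratic_listed L :
  DTIME_quadratic L -> exists e, quad_lang e = L.
Proof.
move=> [M [c LM]]; have [e De] := decode_clocked_surj c M; exists e.
rewrite /quad_lang De; apply/seteqP; split=> w; first by move/(LM w).2.
by move=> Lw; apply/(LM w).2.
Qed.

Definition almost_subset (T : Type) (A B : set T) : Prop :=
  finite_set (A `\` B).

Definition quad_almost_incl (e i : nat) : Prop :=
  almost_subset (quad_lang e) (quad_lang i).

(* Main.v *)
(** The hard half: let [Q x y] mean that some [s] satisfies [R x y s t] for all
    [t].  Call a witness [s] of [(u, v)] alive at time [n] if [R u v s t] holds
    for all [t < n].  An event is a time [n] together with a set [S] of numbers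
    below some [k] that is closed under the pairs with a witness below [k] alive
    at time [n]; only those [n] are used at which some witness below [k] has just
    been refuted (or [n = 0]), so that there are finitely many events for each
    [k].  Put [E x] for the set of events with [x] in [S].  If [Q x y], then
    [E x] is contained in [E y] as soon as [k] exceeds [x], [y] and the witness.
    Otherwise, for every large [k], at the last [n] all living witnesses are
    genuine, and the set of all [v < k] with [Q x v] is an event in [E x] that is
    not in [E y].  No set [S] needs to be guessed or generated by closure, since
    all closed sets are events.

    To decide these sets in quadratic time, a fixed machine computes the events
    one after the other, and a word belongs to the language of [x] iff at time
    the length of the word, the machine has just completed an event of [E x].
    Only the final test whether [x] is in [S] depends on [x]. *)
From HB Require Import structures.
Require Import Defs.
From mathcomp Require Import all_boot.
From mathcomp Require Import boolp classical_sets cardinality.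
From mathcomp Require Import zify.
From Stdlib Require Import RelationClasses.

Set Implicit Arguments.
Unset Strict Implicit.
Unset Printing Implicit Defensive.

Local Open Scope nat_scope.

(** * Computable functions *)

(** Computing the next event may take arbitrarily long, so no time bound is imposed on it: the input
    only serves as a timer, one cell per step, and a slow computation merely spreads the event times
    out. The test at the end must be fast, and two facts make it so. A simulated step raises a
    counter by at most one, so the code of the event just completed is at most the input length. And
    the whole set [S] is computed as one number whose [x]-th bit gives the answer, so the test
    consists of [x] halvings and a parity check: linear time for fixed [x], which fits the clock
    constant [5 * x.+1]. Counter programs are the intermediate language because one counter
    instruction is one machine step, so simulated time and head position agree exactly. The
    parameter [x] enters only as a chain of [x] increments, which makes the map from [x] to an index
    computable. Membership of a word depends only on its length, and each length has finitely many
    words, so finite differences of languages correspond to finite differences of event sets. *)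

Lemma eq_computable n (f g : n.-tuple nat -> nat) :
  f =1 g -> computable f -> computable g.
Proof. by move=> fg [c cf]; exists c => xs; rewrite -fg. Qed.

Lemma computable_tnth n (i : 'I_n) : computable (fun xs => tnth xs i).
Proof. by exists (RProj i). Qed.

Lemma computable_comp m n (f : m.-tuple nat -> nat) (g : 'I_m -> n.-tuple nat -> nat) :
  computable f -> (forall i, computable (g i)) ->
  computable (fun xs => f [tuple g i xs | i < m]).
Proof.
move=> [c cf] /choice[d dg]; exists (RComp c d) => xs /=.
by exists [tuple g i xs | i < m]; split=> // i; rewrite tnth_mktuple.
Qed.

Lemma computable_comp1 n (f : nat -> nat) (g : n.-tuple nat -> nat) :
  computable1 f -> computable g -> computable (fun xs => f (g xs)).
Proof.
move=> cf cg; have := computable_comp cf (fun=> cg); apply: eq_computable => xs.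
by rewrite /thead tnth_mktuple.
Qed.

Lemma computable1P (f : nat -> nat) :
  computable1 f -> computable (fun xs : 1.-tuple nat => f (tnth xs ord0)).
Proof. done. Qed.

Lemma computableS n (f : n.-tuple nat -> nat) :
  computable f -> computable (fun xs => (f xs).+1).
Proof. by apply: (@computable_comp1 _ succn); exists RSucc. Qed.

Lemma computable_const n k : computable (fun _ : n.-tuple nat => k).
Proof. by elim: k => [|k IHk]; [exists (RZero n) | apply: computableS]. Qed.

(** [RPrec] recurs on its first argument; composing it with the tuple of [b xs] followed by [xs]
    gives recursion up to a computed bound. *)
Lemma computable_rec n (a b : n.-tuple nat -> nat) (g : n.+2.-tuple nat -> nat) :
  computable a -> computable b -> computable g ->
  computable (fun xs =>
    nat_rect (fun=> nat) (a xs) (fun i h => g [tuple of i :: h :: xs]) (b xs)).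
Proof.
move=> [ca Ha] cb [cg Hg].
pose F (xs : n.+1.-tuple nat) := nat_rect (fun=> nat) (a [tuple of behead xs])
  (fun i h => g [tuple of i :: h :: [tuple of behead xs]]) (thead xs).
have cF : computable F.
  exists (RPrec ca cg) => xs /=.
  exists (nat_rect (fun=> nat) (a [tuple of behead xs])
    (fun i h => g [tuple of i :: h :: [tuple of behead xs]])); split=> //=.
pose G (i : 'I_n.+1) (xs : n.-tuple nat) :=
  if unlift ord0 i is Some j then tnth xs j else b xs.
have cG i : computable (G i).
  by rewrite /G; case: (unlift ord0 i) => [j|]; [apply: computable_tnth|].
apply: eq_computable (computable_comp cF cG) => xs; rewrite /F.
have -> : [tuple of behead [tuple G i xs | i < n.+1]] = xs.
  apply: eq_from_tnth => i; rewrite tnth_behead tnth_mktuple /G.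
  have -> : inord i.+1 = lift ord0 i.
    by apply: val_inj; rewrite /= inordK // ltnS.
  by rewrite liftK.
by rewrite /thead tnth_mktuple /G unlift_none.
Qed.

Lemma computable_iter n (a b : n.-tuple nat -> nat) (g : nat -> nat) :
  computable a -> computable b -> computable1 g ->
  computable (fun xs => iter (b xs) g (a xs)).
Proof.
move=> ca cb /computable_comp1 cg; have := cg _ _ (computable_tnth (inord 1 : 'I_n.+2)).
move/(computable_rec ca cb); apply: eq_computable => xs.
elim: (b xs) => //= k ->.
by rewrite (tnth_nth 0) inordK.
Qed.

Definition cond (c a b : nat) := if c is 0 then b else a.

Lemma computable_cond n (c a b : n.-tuple nat -> nat) :
  computable a -> computable b -> computable c ->
  computable (fun xs => cond (c xs) (a xs) (b xs)).
Proof.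
move=> ca cb cc.
(* Case analysis is a recursion whose step ignores the index and the previous value, so [a] is
   reindexed past these two arguments. *)
have ca' : computable (fun xs : n.+2.-tuple nat => a [tuple tnth xs (lift ord0 (lift ord0 i)) | i < n]).
  by apply: computable_comp ca _ => i; apply: computable_tnth.
apply: eq_computable (computable_rec cb cc ca') => xs; case: (c xs) => //= k.
by congr a; apply: eq_from_tnth => i; rewrite tnth_mktuple !tnthS.
Qed.

Lemma computable1_id : computable1 id.
Proof. by apply: eq_computable (computable_tnth ord0) . Qed.

Lemma computable1_const k : computable1 (fun=> k).
Proof. exact: computable_const. Qed.

Lemma computable1_comp (f g : nat -> nat) :
  computable1 f -> computable1 g -> computable1 (fun x => f (g x)).
Proof. exact: computable_comp1. Qed.

Lemma computable_addn n (f g : n.-tuple nat -> nat) :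
  computable f -> computable g -> computable (fun xs => f xs + g xs).
Proof.
move=> cf cg; have cs : computable1 succn by exists RSucc.
by apply: eq_computable (computable_iter cg cf cs) => xs; rewrite iter_succn addnC.
Qed.

Lemma computable1_odd : computable1 (fun x => odd x : nat).
Proof.
have c_neg : computable1 (fun h => cond h 0 1).
  exact: computable_cond (computable_const 1 0) (computable_const 1 1) (computable1P computable1_id).
have := computable_iter (computable_const 1 0) (computable1P computable1_id) c_neg.
apply: eq_computable => xs; rewrite /thead; elim: (tnth xs ord0) => //= k ->.
by case: (odd k).
Qed.

Lemma computable1_half : computable1 half.
Proof.
have cg : computable (fun ys : 3.-tuple nat => tnth ys (lift ord0 ord0) + odd (tnth ys ord0)).
  apply: computable_addn; first exact: computable_tnth.
  exact: computable_comp1 computable1_odd (computable_tnth _).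
have := computable_rec (computable_const 1 0) (computable1P computable1_id) cg.
apply: eq_computable => xs; rewrite /thead; elim: (tnth xs ord0) => //= k IH.
by rewrite IH /= uphalf_half addnC.
Qed.

Lemma computable1_double : computable1 double.
Proof.
have := computable_addn (computable1P computable1_id) (computable1P computable1_id).
by apply: eq_computable => xs; rewrite /thead addnn.
Qed.

(** This is the cons step of [CodeSeq.code]: by conversion, [n :: s] has the code
    [code_pair n (CodeSeq.code s)], which is positive, while the empty list has code 0. List
    operations thus become pairing operations and zero tests. *)
Definition code_pair a b := 2 ^ a * b.*2.+1.
(** The exponent of 2 in a positive [m]: the counter grows as long as [m], halved that often, is
    even, and then stays put. Since [a < 2 ^ a], [m] rounds suffice. *)
Definition code_fst m := iter m (fun h => cond (odd (iter h half m)) h h.+1) 0.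
Definition code_snd m := half (iter (code_fst m) half m).

Lemma iter_half_code_pair a b i : i <= a -> iter i half (code_pair a b) = code_pair (a - i) b.
Proof.
rewrite /code_pair; elim: i => [|i IHi] lt_ia; first by rewrite subn0.
rewrite iterS IHi ?(ltnW lt_ia) // -[in LHS](subnSK lt_ia) expnS -mulnA mul2n.
by rewrite doubleK.
Qed.

Lemma code_pair_gt0 a b : 0 < code_pair a b.
Proof. by rewrite muln_gt0 expn_gt0. Qed.

Lemma code_pairK1 a b : code_fst (code_pair a b) = a.
Proof.
rewrite /code_fst; set m := code_pair a b.
have E i : iter i (fun h => cond (odd (iter h half m)) h h.+1) 0 = minn i a.
  elim: i => [|i IHi]; first by rewrite min0n.
  rewrite iterS IHi iter_half_code_pair ?geq_minr // /code_pair.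
  case: (ltnP i a) => [lt_ia|le_ai].
    rewrite (minn_idPl lt_ia).
    by rewrite -(subnSK lt_ia) expnS -mulnA mul2n odd_double.
  rewrite (minn_idPr (leqW le_ai)) subnn mul1n /=.
  by rewrite odd_double.
rewrite E; apply/minn_idPr/ltnW/(leq_trans (ltn_expl a (isT : 1 < 2))).
by rewrite /m /code_pair leq_pmulr.
Qed.

Lemma code_pairK2 a b : code_snd (code_pair a b) = b.
Proof. by rewrite /code_snd code_pairK1 iter_half_code_pair // subnn /code_pair mul1n /= uphalf_double. Qed.

Lemma computable_code_pair n (f g : n.-tuple nat -> nat) :
  computable f -> computable g -> computable (fun xs => code_pair (f xs) (g xs)).
Proof.
move=> cf cg.
have := computable_iter (computableS (computable_comp1 computable1_double cg)) cf computable1_double.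
by apply: eq_computable => xs; rewrite /code_pair; elim: (f xs) => [|k IHk] /=;
  rewrite ?mul1n // IHk expnS -mulnA mul2n.
Qed.

Lemma computable1_code_fst : computable1 code_fst.
Proof.
have cg : computable (fun ys : 3.-tuple nat =>
    cond (odd (iter (tnth ys (lift ord0 ord0)) half (tnth ys (lift ord0 (lift ord0 ord0)))))
      (tnth ys (lift ord0 ord0)) (tnth ys (lift ord0 ord0)).+1).
  apply: computable_cond; [exact: computable_tnth|exact/computableS/computable_tnth|].
  apply: computable_comp1 computable1_odd _.
  by apply: computable_iter computable1_half; apply: computable_tnth.
have := computable_rec (computable_const 1 0) (computable1P computable1_id) cg.
apply: eq_computable => xs; rewrite /thead /code_fst.
elim: {1 2}(tnth xs ord0) => //= k ->.
by rewrite !(tnth_nth 0).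
Qed.

Lemma computable1_code_snd : computable1 code_snd.
Proof.
apply: (computable1_comp computable1_half).
exact: computable_iter (computable1P computable1_id) computable1_code_fst computable1_half.
Qed.

Lemma computable1_code_pair (f g : nat -> nat) :
  computable1 f -> computable1 g -> computable1 (fun x => code_pair (f x) (g x)).
Proof. exact: computable_code_pair. Qed.

Lemma computable1_cond (c f g : nat -> nat) :
  computable1 c -> computable1 f -> computable1 g ->
  computable1 (fun x => cond (c x) (f x) (g x)).
Proof. by move=> cc cf cg; apply: computable_cond. Qed.

(** Index, previous value and parameter are packed in one number, so that recursion stays within the
    unary functions that track maps between coded types. *)
Lemma computable1_rec (f b : nat -> nat) (g : nat -> nat) :
  computable1 f -> computable1 b -> computable1 g ->
  computable1 (fun x =>
    nat_rect (fun=> nat) (f x) (fun i h => g (code_pair (code_pair i h) x)) (b x)).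
Proof.
move=> cf cb cg.
have cg' : computable (fun ys : 3.-tuple nat =>
    g (code_pair (code_pair (tnth ys ord0) (tnth ys (lift ord0 ord0))) (tnth ys (lift ord0 (lift ord0 ord0))))).
  apply: (computable_comp1 cg).
  by do 2?apply: computable_code_pair; apply: computable_tnth.
have := computable_rec cf cb cg'.
apply: eq_computable => xs.
elim: (b (thead xs)) => //= k ->.
by rewrite !(tnth_nth 0) /= /thead (tnth_nth 0).
Qed.

(** * Computable functions between coded types *)

(** Only a map to numbers is recorded. [cmp f] below asks for a computable function that tracks [f]
    on codes; its values at other numbers are arbitrary. *)
Structure encType := EncType { esort :> Type; enc : esort -> nat }.

Canonical nat_encType := EncType (@id nat).
Canonical bool_encType := EncType nat_of_bool.
Canonical prod_encType (A B : encType) :=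
  EncType (fun p : A * B => code_pair (enc p.1) (enc p.2)).
Canonical seq_encType (A : encType) :=
  EncType (fun s : seq A => CodeSeq.code (map (@enc A) s)).

Definition cmp (A B : encType) (f : A -> B) : Prop :=
  exists2 g, computable1 g & forall a, enc (f a) = g (enc a).

Lemma eq_cmp (A B : encType) (f g : A -> B) : f =1 g -> cmp f -> cmp g.
Proof. by move=> fg [h ch fh]; exists h => // a; rewrite -fg. Qed.

Lemma cmp_computable1 (f : nat -> nat) : cmp f <-> computable1 f.
Proof.
split; last by move=> cf; exists f.
by case=> g cg fg; apply: eq_computable cg => xs; rewrite [RHS]fg.
Qed.

Lemma cmp_id (A : encType) : cmp (fun a : A => a).
Proof. by exists id; first exact: computable1_id. Qed.

Lemma cmp_const (A B : encType) (b : B) : cmp (fun _ : A => b).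
Proof. by exists (fun=> enc b); first exact: computable1_const. Qed.

Lemma cmp_app (A B C : encType) (f : B -> C) (g : A -> B) :
  cmp f -> cmp g -> cmp (fun a => f (g a)).
Proof.
move=> [f' cf ff'] [g' cg gg']; exists (fun n => f' (g' n)).
  exact: computable1_comp.
by move=> a; rewrite ff' gg'.
Qed.

Lemma cmp_pair (A B C : encType) (f : A -> B) (g : A -> C) :
  cmp f -> cmp g -> cmp (fun a => (f a, g a)).
Proof.
move=> [f' cf ff'] [g' cg gg']; exists (fun n => code_pair (f' n) (g' n)).
  exact: computable1_code_pair.
by move=> a; rewrite /= ff' gg'.
Qed.

Lemma cmp_fst (A B C : encType) (f : A -> B * C) : cmp f -> cmp (fun a => (f a).1).
Proof. by apply: cmp_app; exists code_fst => [|a]; [exact: computable1_code_fst | rewrite code_pairK1]. Qed.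

Lemma cmp_snd (A B C : encType) (f : A -> B * C) : cmp f -> cmp (fun a => (f a).2).
Proof. by apply: cmp_app; exists code_snd => [|a]; [exact: computable1_code_snd | rewrite code_pairK2]. Qed.

Lemma cmp_app2 (A B C D : encType) (h : B -> C -> D) (f : A -> B) (g : A -> C) :
  cmp (fun p : B * C => h p.1 p.2) -> cmp f -> cmp g -> cmp (fun a => h (f a) (g a)).
Proof.
move=> ch cf cg.
exact: (@cmp_app _ _ _ (fun p : B * C => h p.1 p.2) (fun a => (f a, g a)) ch (cmp_pair cf cg)).
Qed.

Lemma cmp_if (A B : encType) (c : A -> bool) (f g : A -> B) :
  cmp c -> cmp f -> cmp g -> cmp (fun a => if c a then f a else g a).
Proof.
move=> [c' cc ec] [f' cf ef] [g' cg eg].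
exists (fun n => cond (c' n) (f' n) (g' n)); first exact: computable1_cond.
by move=> a; rewrite -ec -ef -eg /=; case: (c a).
Qed.

Lemma cmp_nat_rect (A B : encType) (n : A -> nat) (a : A -> B) (g : nat -> B -> A -> B) :
  cmp n -> cmp a -> cmp (fun p : (nat * B) * A => g p.1.1 p.1.2 p.2) ->
  cmp (fun x => nat_rect (fun=> B) (a x) (fun i h => g i h x) (n x)).
Proof.
move=> [n' cn en] [a' ca ea] [g' cg eg].
exists (fun x => nat_rect (fun=> nat) (a' x) (fun i h => g' (code_pair (code_pair i h) x)) (n' x)).
  exact: computable1_rec.
move=> x; rewrite -en -ea /=; elim: (n x) => //= k <-.
by rewrite (eg (k, _, x)).
Qed.

Lemma cmp_iter (A B : encType) (n : A -> nat) (a : A -> B) (g : B -> A -> B) :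
  cmp n -> cmp a -> cmp (fun p : B * A => g p.1 p.2) ->
  cmp (fun x => iter (n x) (fun h => g h x) (a x)).
Proof.
move=> cn ca cg; have := @cmp_nat_rect A B n a (fun _ h x => g h x) cn ca.
have cp : cmp (fun p : (nat * B) * A => (p.1.2, p.2)).
  by apply: cmp_pair; [apply/cmp_snd/cmp_fst/cmp_id | apply/cmp_snd/cmp_id].
by move/(_ (cmp_app cg cp)); apply: eq_cmp => x; elim: (n x) => //= k ->.
Qed.

Lemma size_code s : size s <= CodeSeq.code s.
Proof.
elim: s => //= n s IHs.
apply: (@leq_trans (CodeSeq.code s).*2.+1); last by rewrite leq_pmull // expn_gt0.
by rewrite ltnS -addnn; apply: leq_trans (leq_addr _ _).
Qed.

(** The iterated state is the accumulator paired with the code of the remaining list; once this code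
    is 0 the state is kept. The code of a list, as a number, is at least its length, so it serves as
    the number of rounds. *)
Lemma cmp_foldl (A B T : encType) (l : A -> seq T) (a : A -> B) (g : B -> T -> A -> B) :
  cmp l -> cmp a -> cmp (fun p : (B * T) * A => g p.1.1 p.1.2 p.2) ->
  cmp (fun x => foldl (fun b t => g b t x) (a x) (l x)).
Proof.
move=> [l' cl el] [a' ca ea] [g' cg eg].
pose st q := let h := code_snd (code_fst q) in
  cond (code_snd h) (code_pair (g' (code_pair (code_pair (code_fst h) (code_fst (code_snd h))) (code_snd q))) (code_snd (code_snd h))) h.
have cst : computable1 st.
  have c1 := computable1_comp computable1_code_snd computable1_code_fst.
  have c2 := computable1_comp computable1_code_snd c1.
  have c3 := computable1_comp computable1_code_fst.
  apply: computable1_cond => //; apply: computable1_code_pair.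
    apply: (computable1_comp cg); apply: computable1_code_pair computable1_code_snd.
    by apply: computable1_code_pair; apply: c3.
  exact: (computable1_comp computable1_code_snd c2).
exists (fun x => code_fst (nat_rect (fun=> nat) (code_pair (a' x) (l' x)) (fun i h => st (code_pair (code_pair i h) x)) (l' x))).
  apply: (computable1_comp computable1_code_fst); apply: computable1_rec => //.
  exact: computable1_code_pair.
move=> x; rewrite -el -ea /=; move: (l x) (a x) => s b.
have le_s : size s <= CodeSeq.code (map (@enc T) s).
  by rewrite -(size_map (@enc T)) size_code.
pose f h := cond (code_snd h) (code_pair (g' (code_pair (code_pair (code_fst h) (code_fst (code_snd h))) (enc x))) (code_snd (code_snd h))) h.
have E N q : nat_rect (fun=> nat) q (fun i h => st (code_pair (code_pair i h) (enc x))) N = iter N f q.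
  by elim: N => //= k ->; rewrite /st code_pairK1 !code_pairK2.
suff H N : forall (s : seq T) (b : B), size s <= N ->
    code_fst (iter N f (code_pair (enc b) (CodeSeq.code (map (@enc T) s)))) =
    enc (foldl (fun b t => g b t x) b s) by rewrite E H.
elim: N {le_s} => [|N IHN] {s b} [|t s] b le_sN //; try by rewrite /= code_pairK1.
  rewrite iterSr {2}/f code_pairK2 [cond _ _ _]/=.
  by rewrite (IHN [::]).
rewrite iterSr {2}/f code_pairK2.
rewrite [map _ _]/= [CodeSeq.code _]/= -/(code_pair (enc t) (CodeSeq.code (map (@enc T) s))).
set r := code_pair (enc t) _; have [m Dm] : exists m, r = m.+1.
  by exists r.-1; rewrite prednK ?code_pair_gt0.
by rewrite {1}Dm /= /r !code_pairK1 !code_pairK2 -(eg (b, t, x)) IHN.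
Qed.

Lemma cmp_cons (A T : encType) (f : A -> T) (g : A -> seq T) :
  cmp f -> cmp g -> cmp (fun x => f x :: g x).
Proof.
by move=> [f' cf ef] [g' cg eg]; exists (fun n => code_pair (f' n) (g' n)) => [|a];
  [exact: computable1_code_pair | rewrite -ef -eg].
Qed.

Lemma cmp_rev (A T : encType) (f : A -> seq T) : cmp f -> cmp (fun x => rev (f x)).
Proof.
move=> cf; have := @cmp_foldl A _ _ f (fun=> [::]) (fun b t _ => t :: b) cf (cmp_const _ _).
move/(_ (cmp_cons (cmp_snd (cmp_fst (cmp_id _))) (cmp_fst (cmp_fst (cmp_id _))))).
by apply: eq_cmp => x; rewrite /rev; elim: (f x) [::] => //= t s IHs b.
Qed.

Lemma cmp_foldr (A B T : encType) (l : A -> seq T) (a : A -> B) (g : T -> B -> A -> B) :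
  cmp l -> cmp a -> cmp (fun p : (T * B) * A => g p.1.1 p.1.2 p.2) ->
  cmp (fun x => foldr (fun t b => g t b x) (a x) (l x)).
Proof.
move=> cl ca cg.
have := @cmp_foldl A B T _ a (fun b t x => g t b x) (cmp_rev cl) ca.
have cp : cmp (fun p : (B * T) * A => ((p.1.2, p.1.1), p.2)).
  apply: cmp_pair; last exact/cmp_snd/cmp_id.
  by apply: cmp_pair; [apply/cmp_snd/cmp_fst/cmp_id | apply/cmp_fst/cmp_fst/cmp_id].
move/(_ (cmp_app cg cp)); apply: eq_cmp => x /=.
by rewrite foldl_rev.
Qed.

Ltac cmp_vars := repeat (first [exact: cmp_id | apply: cmp_fst | apply: cmp_snd]).

Lemma cmp_map (A S T : encType) (l : A -> seq S) (f : S -> A -> T) :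
  cmp l -> cmp (fun p : S * A => f p.1 p.2) ->
  cmp (fun x => map (fun t => f t x) (l x)).
Proof.
move=> cl cf.
have := @cmp_foldr A _ S l (fun=> [::]) (fun t b x => f t x :: b) cl (cmp_const _ _).
move=> H; apply: (eq_cmp _ (H _)) => [x|].
  by elim: (l x) => //= t s ->.
apply: cmp_cons; last by cmp_vars.
by apply: (cmp_app2 cf); cmp_vars.
Qed.

Lemma cmp_cat (A T : encType) (f g : A -> seq T) :
  cmp f -> cmp g -> cmp (fun x => f x ++ g x).
Proof.
move=> cf cg; have := @cmp_foldr A _ T f g (fun t b x => t :: b) cf cg.
move=> H; apply: (eq_cmp _ (H _)) => [x|]; first by elim: (f x) => //= t s ->.
by apply: cmp_cons; cmp_vars.
Qed.

Lemma cmp_flatten (A T : encType) (f : A -> seq (seq T)) :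
  cmp f -> cmp (fun x => flatten (f x)).
Proof.
move=> cf; apply: (@cmp_foldr A _ _ f (fun=> [::]) (fun t b x => t ++ b) cf (cmp_const _ _)).
by apply: cmp_cat; cmp_vars.
Qed.

Lemma cmp_filter (A T : encType) (l : A -> seq T) (p : T -> A -> bool) :
  cmp l -> cmp (fun q : T * A => p q.1 q.2) ->
  cmp (fun x => filter (fun t => p t x) (l x)).
Proof.
move=> cl cp.
have := @cmp_foldr A _ T l (fun=> [::]) (fun t b x => if p t x then t :: b else b) cl (cmp_const _ _).
apply; apply: cmp_if; [|apply: cmp_cons; cmp_vars|cmp_vars].
by apply: (cmp_app2 cp); cmp_vars.
Qed.

Lemma cmp_all (A T : encType) (l : A -> seq T) (p : T -> A -> bool) :
  cmp l -> cmp (fun q : T * A => p q.1 q.2) ->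
  cmp (fun x => all (fun t => p t x) (l x)).
Proof.
move=> cl cp.
have := @cmp_foldr A _ T l (fun=> true) (fun t b x => if p t x then b else false) cl (cmp_const _ _).
apply; apply: cmp_if; [|cmp_vars|exact: cmp_const].
by apply: (cmp_app2 cp); cmp_vars.
Qed.

Lemma cmp_negb (A : encType) (b : A -> bool) : cmp b -> cmp (fun x => ~~ b x).
Proof. by move=> cb; apply: cmp_if; [|exact: cmp_const..]. Qed.

Lemma cmp_andb (A : encType) (b c : A -> bool) : cmp b -> cmp c -> cmp (fun x => b x && c x).
Proof. by move=> cb cc; apply: cmp_if => //; apply: cmp_const. Qed.

Lemma cmp_orb (A : encType) (b c : A -> bool) : cmp b -> cmp c -> cmp (fun x => b x || c x).
Proof. by move=> cb cc; apply: cmp_if => //; apply: cmp_const. Qed.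

Lemma cmp_implb (A : encType) (b c : A -> bool) : cmp b -> cmp c -> cmp (fun x => b x ==> c x).
Proof. by move=> cb cc; apply: cmp_if => //; apply: cmp_const. Qed.

Lemma cmp_has (A T : encType) (l : A -> seq T) (p : T -> A -> bool) :
  cmp l -> cmp (fun q : T * A => p q.1 q.2) ->
  cmp (fun x => has (fun t => p t x) (l x)).
Proof.
move=> cl cp; have := cmp_negb (@cmp_all _ _ l (fun t x => ~~ p t x) cl (cmp_negb cp)).
by apply: eq_cmp => x; rewrite -has_predC; apply: eq_has => t /=; rewrite negbK.
Qed.

Lemma cmp_behead (A T : encType) (f : A -> seq T) : cmp f -> cmp (fun x => behead (f x)).
Proof.
apply: cmp_app; exists code_snd => [|s]; first exact: computable1_code_snd.
(* The empty list is settled by computation, as [code_snd 0] is 0. *)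
case: s => // t s; exact/esym/(code_pairK2 (enc t) (CodeSeq.code (map (@enc T) s))).
Qed.

Lemma cmp_head (A T : encType) (d : T) (f : A -> seq T) :
  cmp f -> cmp (fun x => head d (f x)).
Proof.
apply: cmp_app; exists (fun n => cond n (code_fst n) (enc d)) => [|[//|t s]].
  by apply: computable1_cond computable1_id computable1_code_fst (computable1_const _).
rewrite [head _ _]/=; set n := enc (t :: s).
have -> : cond n (code_fst n) (enc d) = code_fst n.
  by case: n (code_pair_gt0 (enc t) (CodeSeq.code (map (@enc T) s)) : 0 < n).
by rewrite [n]/(code_pair (enc t) _) code_pairK1.
Qed.

Lemma cmp_drop (A T : encType) (n : A -> nat) (f : A -> seq T) :
  cmp n -> cmp f -> cmp (fun x => drop (n x) (f x)).
Proof.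
move=> cn cf; have := @cmp_iter A _ n f (fun s _ => behead s) cn cf.
move=> H; apply: (eq_cmp _ (H _)) => [x|]; last by apply: cmp_behead; cmp_vars.
elim: (n x) (f x) => [|k IHk] s; first by rewrite drop0.
by rewrite iterSr IHk; case: s.
Qed.

Lemma cmp_nth (A T : encType) (d : T) (n : A -> nat) (f : A -> seq T) :
  cmp n -> cmp f -> cmp (fun x => nth d (f x) (n x)).
Proof.
move=> cn cf; apply: eq_cmp (cmp_head d (cmp_drop cn cf)) => x.
by rewrite -nth0 nth_drop addn0.
Qed.

Lemma cmp_S (A : encType) (f : A -> nat) : cmp f -> cmp (fun x => (f x).+1).
Proof. by apply: cmp_app; exists succn => //; apply: (computableS (computable1P computable1_id)). Qed.

Lemma cmp_addn (A : encType) (f g : A -> nat) : cmp f -> cmp g -> cmp (fun x => f x + g x).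
Proof.
move=> cf cg; have := @cmp_iter A _ g f (fun n _ => n.+1) cg cf.
move=> H; apply: (eq_cmp _ (H _)) => [x|]; first by rewrite iter_succn addnC.
by apply: cmp_S; cmp_vars.
Qed.

Lemma cmp_muln (A : encType) (f g : A -> nat) : cmp f -> cmp g -> cmp (fun x => f x * g x).
Proof.
move=> cf cg; have := @cmp_iter A _ f (fun=> 0) (fun n x => g x + n) cf (cmp_const _ _).
move=> H; apply: (eq_cmp _ (H _)) => [x|]; first by elim: (f x) => //= k ->; rewrite mulSn.
by apply: cmp_addn; [apply: (cmp_app cg)|]; cmp_vars.
Qed.

Lemma cmp_predn (A : encType) (f : A -> nat) : cmp f -> cmp (fun x => (f x).-1).
Proof.
move=> cf; have := @cmp_nat_rect A _ f (fun=> 0) (fun i _ _ => i) cf (cmp_const _ _).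
move=> H; apply: (eq_cmp _ (H _)) => [x|]; first by case: (f x).
by cmp_vars.
Qed.

Lemma cmp_subn (A : encType) (f g : A -> nat) : cmp f -> cmp g -> cmp (fun x => f x - g x).
Proof.
move=> cf cg; have := @cmp_iter A _ g f (fun n _ => n.-1) cg cf.
move=> H; apply: (eq_cmp _ (H _)) => [x|].
  by elim: (g x) => [|k]; rewrite ?subn0 //= subnS => ->.
by apply: cmp_predn; cmp_vars.
Qed.

Lemma cmp_eq0 (A : encType) (f : A -> nat) : cmp f -> cmp (fun x => f x == 0).
Proof.
apply: (@cmp_app A nat_encType bool_encType (fun n => n == 0)); exists (fun n => cond n 0 1) => [|[]] //.
exact: computable1_cond computable1_id (computable1_const _) (computable1_const _).
Qed.

Lemma cmp_leq (A : encType) (f g : A -> nat) : cmp f -> cmp g -> cmp (fun x => f x <= g x).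
Proof. by move=> cf cg; exact: (cmp_eq0 (cmp_subn cf cg)). Qed.

Lemma cmp_eqn (A : encType) (f g : A -> nat) : cmp f -> cmp g -> cmp (fun x => f x == g x).
Proof.
move=> cf cg; apply: eq_cmp (cmp_andb (cmp_leq cf cg) (cmp_leq cg cf)) => x.
by rewrite eqn_leq.
Qed.

Lemma cmp_code (A : encType) (f : A -> seq nat) : cmp f -> cmp (fun x => CodeSeq.code (f x)).
Proof. by apply: cmp_app; exists id => [|s]; [exact: computable1_id | rewrite /= map_id]. Qed.

Lemma cmp_decode (A : encType) (f : A -> nat) : cmp f -> cmp (fun x => CodeSeq.decode (f x)).
Proof.
apply: cmp_app; exists id => [|n]; first exact: computable1_id.
by rewrite /= map_id CodeSeq.decodeK.
Qed.

Lemma cmp_eqseq (A : encType) (f g : A -> seq nat) : cmp f -> cmp g -> cmp (fun x => f x == g x).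
Proof.
move=> cf cg; apply: eq_cmp (cmp_eqn (cmp_code cf) (cmp_code cg)) => x.
by rewrite (can_eq CodeSeq.codeK).
Qed.

Lemma cmp_size (A T : encType) (f : A -> seq T) : cmp f -> cmp (fun x => size (f x)).
Proof.
move=> cf; have := @cmp_foldr A _ T f (fun=> 0) (fun _ n _ => n.+1) cf (cmp_const _ _).
move=> H; apply: (eq_cmp _ (H _)) => [x|]; first by elim: (f x) => //= t s ->.
by apply: cmp_S; cmp_vars.
Qed.

Lemma cmp_iota (A : encType) (m n : A -> nat) : cmp m -> cmp n -> cmp (fun x => iota (m x) (n x)).
Proof.
move=> cm cn.
have := @cmp_nat_rect A _ n (fun=> [::]) (fun i s x => s ++ [:: m x + i]) cn (cmp_const _ _).
move=> H; apply: (eq_cmp _ (H _)) => [x|].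
  by elim: (n x) => //= k ->; rewrite -[LHS]/(iota (m x) k ++ iota (m x + k) 1) -iotaD addn1.
apply: cmp_cat; first by cmp_vars.
apply: cmp_cons (cmp_const _ _); apply: cmp_addn; last by cmp_vars.
by apply: (cmp_app cm); cmp_vars.
Qed.

Lemma cmp_odd (A : encType) (f : A -> nat) : cmp f -> cmp (fun x => odd (f x)).
Proof. by apply: cmp_app; exists (fun n => odd n : nat); first exact: computable1_odd. Qed.

Lemma cmp_nseq (A T : encType) (n : A -> nat) (t : T) : cmp n -> cmp (fun x => nseq (n x) t).
Proof.
move=> cn; have := @cmp_iter A _ n (fun=> [::]) (fun s _ => t :: s) cn (cmp_const _ _).
move=> H; apply: (eq_cmp _ (H _)) => [x|]; first by elim: (n x) => //= k ->.
by apply: cmp_cons; [exact: cmp_const | cmp_vars].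
Qed.

Lemma cmp_zip_map (A S1 S2 T : encType) (d1 : S1) (d2 : S2)
    (l1 : A -> seq S1) (l2 : A -> seq S2) (f : S1 -> S2 -> T) :
  cmp l1 -> cmp l2 -> cmp (fun p : S1 * S2 => f p.1 p.2) ->
  cmp (fun x => [seq f p.1 p.2 | p <- zip (l1 x) (l2 x)]).
Proof.
move=> c1 c2 cf.
(* The zip is replaced by a map over positions; [m - (m - n)] is the smaller of the two lengths. *)
have H := @cmp_map A _ T (fun x => iota 0 (size (l1 x) - (size (l1 x) - size (l2 x))))
  (fun i x => f (nth d1 (l1 x) i) (nth d2 (l2 x) i)).
apply: (eq_cmp _ (H _ _)) => [x||].
- rewrite -minnE; apply: (@eq_from_nth _ (f d1 d2)); rewrite !size_map size_iota ?size_zip //.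
  move=> i lti; rewrite (nth_map 0) ?size_iota // nth_iota // add0n.
  by rewrite (nth_map (d1, d2)) ?size_zip // nth_zip_cond size_zip lti.
- apply: cmp_iota (cmp_const _ _) _; apply: cmp_subn; first exact: cmp_size.
  by apply: cmp_subn; apply: cmp_size.
- by apply: (cmp_app2 cf); apply: cmp_nth; cmp_vars; [apply: (cmp_app c1)|apply: (cmp_app c2)]; cmp_vars.
Qed.

(** * Simulation of clocked machines *)

Definition direction_code (d : direction) :=
  match d with Left => 0 | Stay => 1 | Right => 2 end.

Canonical direction_encType := EncType direction_code.
(* These encodings are sections of the decodings of [Defs]. *)
Canonical action_encType :=
  EncType (fun a => CodeSeq.code [:: reads a; writes a; enc (moves a)]).
Canonical rule_encType :=
  EncType (fun r => CodeSeq.code [:: source r, target r & map (@enc _) (actions r)]).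
Canonical machine_encType :=
  EncType (fun M => CodeSeq.code (work_tapes M :: map (@enc _) (rules M))).
Canonical tape_encType :=
  EncType (fun t => enc (lcells t, (scanned t, rcells t))).
Canonical config_encType := EncType (fun c => enc (state c, tapes c)).

(** For changes of type that leave the code untouched: a record has the same code as a suitable
    nested pair or list, so its projections and constructor are inherited from pairs. *)
Lemma cmp_unenc (A B C : encType) (i : B -> C) (f : A -> B) :
  (forall b, enc (i b) = enc b) -> cmp f -> cmp (fun x => i (f x)).
Proof. by move=> ei [g cg fg]; exists g => // a; rewrite ei. Qed.

Lemma cmp_reads (A : encType) (f : A -> action) : cmp f -> cmp (fun x => reads (f x)).
Proof.
by move/(@cmp_unenc _ _ (prod_encType nat_encType (seq_encType nat_encType))
  (fun a => (reads a, [:: writes a; enc (moves a)]))) => H; apply: (cmp_fst (H _)).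
Qed.

Lemma cmp_writes (A : encType) (f : A -> action) : cmp f -> cmp (fun x => writes (f x)).
Proof.
by move/(@cmp_unenc _ _ (prod_encType nat_encType (prod_encType nat_encType (seq_encType nat_encType)))
  (fun a => (reads a, (writes a, [:: enc (moves a)])))) => H; apply: (cmp_fst (cmp_snd (H _))).
Qed.

Lemma cmp_moves (A : encType) (f : A -> action) : cmp f -> cmp (fun x => moves (f x)).
Proof.
by move/(@cmp_unenc _ _ (prod_encType nat_encType (prod_encType nat_encType
   (prod_encType direction_encType (seq_encType nat_encType))))
  (fun a => (reads a, (writes a, (moves a, [::]))))) => H; apply: (cmp_fst (cmp_snd (cmp_snd (H _)))).
Qed.

Lemma cmp_Action (A : encType) (r w : A -> nat) (d : A -> direction) :
  cmp r -> cmp w -> cmp d -> cmp (fun x => Action (r x) (w x) (d x)).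
Proof.
move=> cr cw cd.
have c := cmp_pair cr (cmp_pair cw (cmp_pair cd (cmp_const _ ([::] : seq nat)))).
by case: c => g cg eg; exists g => // x; rewrite -eg.
Qed.

Lemma cmp_source (A : encType) (f : A -> rule) : cmp f -> cmp (fun x => source (f x)).
Proof.
by move/(@cmp_unenc _ _ (prod_encType nat_encType (prod_encType nat_encType (seq_encType action_encType)))
  (fun a => (source a, (target a, actions a)))) => H; apply: (cmp_fst (H _)).
Qed.

Lemma cmp_target (A : encType) (f : A -> rule) : cmp f -> cmp (fun x => target (f x)).
Proof.
by move/(@cmp_unenc _ _ (prod_encType nat_encType (prod_encType nat_encType (seq_encType action_encType)))
  (fun a => (source a, (target a, actions a)))) => H; apply: (cmp_fst (cmp_snd (H _))).
Qed.

Lemma cmp_actions (A : encType) (f : A -> rule) : cmp f -> cmp (fun x => actions (f x)).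
Proof.
by move/(@cmp_unenc _ _ (prod_encType nat_encType (prod_encType nat_encType (seq_encType action_encType)))
  (fun a => (source a, (target a, actions a)))) => H; apply: (cmp_snd (cmp_snd (H _))).
Qed.

Lemma cmp_Rule (A : encType) (p q : A -> nat) (s : A -> seq action) :
  cmp p -> cmp q -> cmp s -> cmp (fun x => Rule (p x) (q x) (s x)).
Proof.
move=> cp cq cs; have c := cmp_pair cp (cmp_pair cq cs).
by have := @cmp_unenc _ _ rule_encType (fun p => Rule p.1 p.2.1 p.2.2) _ _ c; apply.
Qed.

Lemma cmp_work_tapes (A : encType) (f : A -> machine) : cmp f -> cmp (fun x => work_tapes (f x)).
Proof.
by move/(@cmp_unenc _ _ (prod_encType nat_encType (seq_encType rule_encType))
  (fun a => (work_tapes a, rules a))) => H; apply: (cmp_fst (H _)).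
Qed.

Lemma cmp_rules (A : encType) (f : A -> machine) : cmp f -> cmp (fun x => rules (f x)).
Proof.
by move/(@cmp_unenc _ _ (prod_encType nat_encType (seq_encType rule_encType))
  (fun a => (work_tapes a, rules a))) => H; apply: (cmp_snd (H _)).
Qed.

Lemma cmp_Machine (A : encType) (p : A -> nat) (s : A -> seq rule) :
  cmp p -> cmp s -> cmp (fun x => Machine (p x) (s x)).
Proof.
move=> cp cs.
by have := @cmp_unenc _ _ machine_encType (fun p => Machine p.1 p.2) _ _ (cmp_pair cp cs); apply.
Qed.

Lemma cmp_lcells (A : encType) (f : A -> tape) : cmp f -> cmp (fun x => lcells (f x)).
Proof.
by move/(@cmp_unenc _ _ (prod_encType (seq_encType nat_encType) (prod_encType nat_encType (seq_encType nat_encType)))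
  (fun a => (lcells a, (scanned a, rcells a)))) => H; apply: (cmp_fst (H _)).
Qed.

Lemma cmp_scanned (A : encType) (f : A -> tape) : cmp f -> cmp (fun x => scanned (f x)).
Proof.
by move/(@cmp_unenc _ _ (prod_encType (seq_encType nat_encType) (prod_encType nat_encType (seq_encType nat_encType)))
  (fun a => (lcells a, (scanned a, rcells a)))) => H; apply: (cmp_fst (cmp_snd (H _))).
Qed.

Lemma cmp_rcells (A : encType) (f : A -> tape) : cmp f -> cmp (fun x => rcells (f x)).
Proof.
by move/(@cmp_unenc _ _ (prod_encType (seq_encType nat_encType) (prod_encType nat_encType (seq_encType nat_encType)))
  (fun a => (lcells a, (scanned a, rcells a)))) => H; apply: (cmp_snd (cmp_snd (H _))).
Qed.

Lemma cmp_Tape (A : encType) (l : A -> seq nat) (s : A -> nat) (r : A -> seq nat) :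
  cmp l -> cmp s -> cmp r -> cmp (fun x => Tape (l x) (s x) (r x)).
Proof.
move=> cl cs cr; have c := cmp_pair cl (cmp_pair cs cr).
by have := @cmp_unenc _ _ tape_encType (fun p => Tape p.1 p.2.1 p.2.2) _ _ c; apply.
Qed.

Lemma cmp_state (A : encType) (f : A -> config) : cmp f -> cmp (fun x => state (f x)).
Proof.
by move/(@cmp_unenc _ _ (prod_encType nat_encType (seq_encType tape_encType))
  (fun a => (state a, tapes a))) => H; apply: (cmp_fst (H _)).
Qed.

Lemma cmp_tapes (A : encType) (f : A -> config) : cmp f -> cmp (fun x => tapes (f x)).
Proof.
by move/(@cmp_unenc _ _ (prod_encType nat_encType (seq_encType tape_encType))
  (fun a => (state a, tapes a))) => H; apply: (cmp_snd (H _)).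
Qed.

Lemma cmp_Config (A : encType) (p : A -> nat) (s : A -> seq tape) :
  cmp p -> cmp s -> cmp (fun x => Config (p x) (s x)).
Proof.
move=> cp cs.
by have := @cmp_unenc _ _ config_encType (fun p => Config p.1 p.2) _ _ (cmp_pair cp cs); apply.
Qed.

Lemma cmp_direction (A B : encType) (d : A -> direction) (f g h : A -> B) :
  cmp d -> cmp f -> cmp g -> cmp h ->
  cmp (fun x => match d x with Left => f x | Stay => g x | Right => h x end).
Proof.
move=> cd cf cg ch.
have cn := @cmp_unenc _ _ nat_encType direction_code d (fun _ => erefl) cd.
have := cmp_if (cmp_eq0 cn) cf (cmp_if (cmp_eq0 (cmp_predn cn)) cg ch).
by apply: eq_cmp => x; case: (d x).
Qed.

Lemma cmp_decode_direction (A : encType) (f : A -> nat) :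
  cmp f -> cmp (fun x => decode_direction (f x)).
Proof.
move=> cf.
have := cmp_if (cmp_eq0 cf) (cmp_const _ Left)
  (cmp_if (cmp_eq0 (cmp_predn cf)) (cmp_const _ Stay) (cmp_const _ Right)).
by apply: eq_cmp => x; case: (f x) => [|[]].
Qed.

Lemma cmp_decode_action (A : encType) (f : A -> nat) :
  cmp f -> cmp (fun x => decode_action (f x)).
Proof.
move=> cf; have c k := cmp_nth 0 (cmp_const _ k) (cmp_decode cf).
exact: cmp_Action (c 0) (c 1) (cmp_decode_direction (c 2)).
Qed.

Lemma cmp_decode_rule (A : encType) (f : A -> nat) :
  cmp f -> cmp (fun x => decode_rule (f x)).
Proof.
move=> cf; have c k := cmp_nth 0 (cmp_const _ k) (cmp_decode cf).
apply: (cmp_Rule (c 0) (c 1)).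
apply: (@cmp_map _ _ _ _ (fun n _ => decode_action n)).
  by apply: cmp_drop (cmp_const _ _) _; apply: cmp_decode.
by apply: cmp_decode_action; cmp_vars.
Qed.

Lemma cmp_decode_clocked (A : encType) (f : A -> nat) :
  cmp f -> cmp (fun x => decode_clocked (f x)).
Proof.
move=> cf; have c k := cmp_nth 0 (cmp_const _ k) (cmp_decode cf).
apply: (cmp_pair (c 0)); apply: (cmp_Machine (c 1)).
apply: (@cmp_map _ _ _ _ (fun n _ => decode_rule n)).
  by apply: cmp_drop (cmp_const _ _) _; apply: cmp_decode.
by apply: cmp_decode_rule; cmp_vars.
Qed.

Lemma cmp_act (A : encType) (a : A -> action) (t : A -> tape) :
  cmp a -> cmp t -> cmp (fun x => act (a x) (t x)).
Proof.
move=> ca ct.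
have cl := cmp_lcells ct; have cr := cmp_rcells ct; have cw := cmp_writes ca.
have := cmp_direction (cmp_moves ca)
  (cmp_Tape (cmp_behead cl) (cmp_head 0 cl) (cmp_cons cw cr))
  (cmp_Tape cl cw cr)
  (cmp_Tape (cmp_cons cw cl) (cmp_head 0 cr) (cmp_behead cr)).
by apply: eq_cmp => x; case: (t x) => l s r; case: (a x) => r' w [].
Qed.

Lemma cmp_applicable (A : encType) (c : A -> config) (r : A -> rule) :
  cmp c -> cmp r -> cmp (fun x => applicable (c x) (r x)).
Proof.
move=> cc cr; apply: cmp_andb; first exact: cmp_eqn (cmp_source cr) (cmp_state cc).
apply: cmp_eqseq.
- by apply: (@cmp_map _ _ _ _ (fun a _ => reads a) (cmp_actions cr)); apply: cmp_reads; cmp_vars.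
- by apply: (@cmp_map _ _ _ _ (fun a _ => scanned a) (cmp_tapes cc)); apply: cmp_scanned; cmp_vars.
Qed.

Lemma cmp_apply_rule (A : encType) (c : A -> config) (r : A -> rule) :
  cmp c -> cmp r -> cmp (fun x => apply_rule (r x) (c x)).
Proof.
move=> cc cr; apply: (cmp_Config (cmp_target cr)).
apply: (@cmp_zip_map _ _ _ _ (Action 0 0 Stay) blank_tape _ _ act (cmp_actions cr) (cmp_tapes cc)).
by apply: cmp_act; cmp_vars.
Qed.

Lemma cmp_step (A : encType) (M : A -> machine) (c : A -> config) :
  cmp M -> cmp c -> cmp (fun x => step (M x) (c x)).
Proof.
move=> cM cc.
have cf := @cmp_filter _ _ _ (fun r x => applicable (c x) r) (cmp_rules cM).
have {}cf : cmp (fun x => [seq r <- rules (M x) | applicable (c x) r]).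
  by apply: cf; apply: cmp_applicable; [apply: (cmp_app cc)|]; cmp_vars.
have := cmp_if (cmp_eq0 (cmp_size cf)) cc
  (cmp_apply_rule cc (cmp_head (Rule 0 0 [::]) cf)).
by apply: eq_cmp => x; rewrite /step; case: filter.
Qed.

Lemma cmp_halted (A : encType) (M : A -> machine) (c : A -> config) :
  cmp M -> cmp c -> cmp (fun x => halted (M x) (c x)).
Proof.
move=> cM cc; apply: cmp_negb.
apply: (@cmp_has _ _ _ (fun r x => applicable (c x) r) (cmp_rules cM)).
by apply: cmp_applicable; [apply: (cmp_app cc)|]; cmp_vars.
Qed.

Lemma cmp_init (A : encType) (M : A -> machine) (w : A -> word) :
  cmp M -> cmp w -> cmp (fun x => init (M x) (w x)).
Proof.
move=> cM cw; apply: (cmp_Config (cmp_const _ 0)).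
apply: cmp_cons; last by apply: cmp_nseq; apply: cmp_work_tapes.
have c : cmp (fun x => [seq (nat_of_bool b).+1 | b <- w x]).
  apply: (@cmp_map _ _ _ _ (fun (b : bool) _ => (nat_of_bool b).+1) cw).
  apply: cmp_S; apply: (@cmp_unenc _ bool_encType nat_encType nat_of_bool) => //.
  by cmp_vars.
exact: cmp_Tape (cmp_const _ _) (cmp_head 0 c) (cmp_behead c).
Qed.

Lemma cmp_run (A : encType) (M : A -> machine) (w : A -> word) (T : A -> nat) :
  cmp M -> cmp w -> cmp T -> cmp (fun x => run (M x) (w x) (T x)).
Proof.
move=> cM cw cT.
apply: (@cmp_iter _ _ T _ (fun c x => step (M x) c) cT (cmp_init cM cw)).
by apply: cmp_step; [apply: (cmp_app cM)|]; cmp_vars.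
Qed.

Lemma cmp_accepts_within (A : encType) (M : A -> machine) (w : A -> word) (T : A -> nat) :
  cmp M -> cmp w -> cmp T -> cmp (fun x => accepts_within (M x) (w x) (T x)).
Proof.
move=> cM cw cT; have cr := cmp_run cM cw cT.
apply: cmp_andb; first exact: cmp_halted.
exact: cmp_eqn (cmp_state cr) (cmp_const _ 1).
Qed.

(** * Almost inclusion is a $\Sigma^0_2$ preorder *)

Definition quad_accepts (e : nat) (w : word) : bool :=
  accepts_within (decode_clocked e).2 w (quad_bound (decode_clocked e).1 (size w)).

Lemma cmp_quad_accepts (A : encType) (e : A -> nat) (w : A -> word) :
  cmp e -> cmp w -> cmp (fun x => quad_accepts (e x) (w x)).
Proof.
move=> ce cw; have cd := cmp_decode_clocked ce; have cs := cmp_size cw.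
apply: cmp_accepts_within (cmp_snd cd) cw _.
apply: (cmp_muln (cmp_fst cd)); apply: cmp_addn _ (cmp_const _ 1).
exact: (cmp_muln cs cs).
Qed.

Lemma quad_langE e w : quad_lang e w <-> quad_accepts e w.
Proof. by rewrite /quad_lang /quad_accepts; case: (decode_clocked e). Qed.

(** Taking parities makes every number denote a word, so a quantifier over numbers is one over
    words. *)
Definition word_of (n : nat) : word := map odd (CodeSeq.decode n).

Lemma word_of_surj w : exists n, word_of n = w.
Proof.
exists (CodeSeq.code (map nat_of_bool w)).
by rewrite /word_of CodeSeq.codeK -map_comp (eq_map oddb) map_id.
Qed.

(** The alphabet is finite, so there are finitely many words of each length. *)
Lemma finite_words (S : set word) :
  finite_set S <-> exists s, forall w, S w -> size w <= s.
Proof.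
split=> [/finite_seqP[l ->]|[s Ss]].
  by exists (\max_(w <- l) size w) => w /= wl; apply: leq_bigmax_seq.
pose l := flatten [seq [seq tval t | t <- enum {: n.-tuple bool}] | n <- iota 0 s.+1].
apply: (@sub_finite_set _ _ [set` l]%classic); last exact: finite_seq.
move=> w /Ss le_ws /=; apply/flatten_mapP; exists (size w); first by rewrite mem_iota.
by apply/mapP; exists (in_tuple w); rewrite ?mem_enum.
Qed.

(** Bounding lengths instead of asserting finiteness gives an existential-universal form with a
    decidable matrix. *)
Lemma quad_almost_inclE e i :
  quad_almost_incl e i <->
  exists s, forall w, size w <= s \/ (quad_accepts e w -> quad_accepts i w).
Proof.
rewrite /quad_almost_incl /almost_subset finite_words; split=> -[s H]; exists s => w.
  case: (leqP (size w) s) => [|lt_sw]; [by left | right=> /quad_langE ew].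
  apply/quad_langE; apply/not_notP => iw.
  by move: (H w (conj ew iw)); rewrite leqNgt lt_sw.
by move=> [/quad_langE ew iw]; case: (H w) => // /(_ ew) /quad_langE.
Qed.

Lemma tuple4_computable (R : nat * (nat * (nat * nat)) -> bool) : cmp R ->
  computable_pred (fun xs : 4.-tuple nat =>
    R (tnth xs (inord 0), (tnth xs (inord 1), (tnth xs (inord 2), tnth xs (inord 3))))).
Proof.
move=> [g cg gR].
have c : computable (fun xs : 4.-tuple nat =>
  code_pair (tnth xs (inord 0)) (code_pair (tnth xs (inord 1)) (code_pair (tnth xs (inord 2)) (tnth xs (inord 3))))).
  by do 3?apply: computable_code_pair; apply: computable_tnth.
by apply: eq_computable (computable_comp1 cg c) => xs; apply/esym/gR.
Qed.

Lemma cmp_tuple4 (R : 4.-tuple nat -> bool) : computable_pred R ->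
  cmp (fun p : nat * (nat * (nat * nat)) => R [tuple p.1; p.2.1; p.2.2.1; p.2.2.2]).
Proof.
move=> cR; pose g (i : 'I_4) n := nth 0 [:: code_fst n; code_fst (code_snd n); code_fst (code_snd (code_snd n)); code_snd (code_snd (code_snd n))] i.
have ctl k : computable1 (iter k code_snd).
  elim: k => [|k IHk]; first exact: computable1_id.
  exact: computable1_comp computable1_code_snd IHk.
have cg i : computable1 (g i).
  rewrite /g; case: i => -[|[|[|[|//]]]] /= _; [exact: computable1_code_fst|..|exact: (ctl 3)].
    exact: computable1_comp computable1_code_fst (ctl 1).
  exact: computable1_comp computable1_code_fst (ctl 2).
exists (fun n => R [tuple g i n | i < 4]).
  exact: (computable_comp cR cg).
move=> [x [y [s t]]] /=; congr (nat_of_bool (R _)); apply: eq_from_tnth => i.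
rewrite tnth_mktuple /g !code_pairK1 !code_pairK2 !code_pairK1 (tnth_nth 0).
by case: i => -[|[|[|[|//]]]].
Qed.

Lemma Sigma02_quad_almost_incl : Sigma02 quad_almost_incl.
Proof.
pose R (p : nat * (nat * (nat * nat))) :=
  let w := word_of p.2.2.2 in
  (size w <= p.2.2.1) || (quad_accepts p.1 w ==> quad_accepts p.2.1 w).
have cR : cmp R.
  have cw : cmp (fun p : nat * (nat * (nat * nat)) => word_of p.2.2.2).
    apply: (@cmp_map _ _ _ _ (fun n _ => odd n)); first by apply: cmp_decode; cmp_vars.
    by apply: cmp_odd; cmp_vars.
  apply: cmp_orb; first by apply: cmp_leq (cmp_size cw) _; cmp_vars.
  by apply: cmp_implb; apply: cmp_quad_accepts cw; cmp_vars.
exists (fun xs : 4.-tuple nat =>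
    R (tnth xs (inord 0), (tnth xs (inord 1), (tnth xs (inord 2), tnth xs (inord 3))))).
  exact: tuple4_computable.
move=> e i; rewrite quad_almost_inclE; split=> -[s H]; exists s.
  move=> t; rewrite !(tnth_nth 0) !inordK //= /R /=.
  by case: (H (word_of t)) => [->|/implyP->] //; rewrite orbT.
move=> w; have [t <-] := word_of_surj w; move: (H t).
rewrite !(tnth_nth 0) !inordK //= /R /= => /orP[|/implyP]; by [left|right].
Qed.

Lemma PreOrder_quad_almost_incl : PreOrder quad_almost_incl.
Proof.
split=> [e|e i j].
  by apply/quad_almost_inclE; exists 0 => w; right.
move=> /quad_almost_inclE[s Hs] /quad_almost_inclE[t Ht]; apply/quad_almost_inclE.
exists (maxn s t) => w; rewrite leq_max.
case: (Hs w) => [->|ei]; first by left.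
case: (Ht w) => [->|ij]; first by left; rewrite orbT.
by right=> /ei.
Qed.

(** * Counter programs *)

(** The body of a loop may change the loop register again, so loops are unbounded and can express
    minimization. *)
Inductive prog := Nop | Inc of nat | Dec of nat | Seq of prog & prog | Loop of nat & prog.

Definition upd (s : nat -> nat) r v : nat -> nat := fun i => if i == r then v else s i.

Lemma upd_id s r : upd s r (s r) = s.
Proof. by apply: funext => i; rewrite /upd; case: eqP => // ->. Qed.

Lemma upd_upd s r v w : upd (upd s r v) r w = upd s r w.
Proof. by apply: funext => i; rewrite /upd; case: eqP. Qed.

Lemma updE s r v : upd s r v r = v.
Proof. by rewrite /upd eqxx. Qed.

Lemma updN s r v i : i != r -> upd s r v i = s i.
Proof. by rewrite /upd => /negPf ->. Qed.

Lemma updC s r v q w : r != q -> upd (upd s r v) q w = upd (upd s q w) r v.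
Proof.
move=> rq; apply: funext => i; rewrite /upd.
by case: (eqVneq i q) => // ->; rewrite eq_sym (negPf rq).
Qed.

(* [Loop r p] decrements [r] before each execution of [p]. *)
Inductive exec : prog -> (nat -> nat) -> nat -> (nat -> nat) -> Prop :=
| ExNop s : exec Nop s 1 s
| ExInc r s : exec (Inc r) s 1 (upd s r (s r).+1)
| ExDec r s : exec (Dec r) s 1 (upd s r (s r).-1)
| ExSeq p q s t s' t' s'' :
    exec p s t s' -> exec q s' t' s'' -> exec (Seq p q) s (t + t') s''
| ExLoop0 r p s : s r = 0 -> exec (Loop r p) s 1 s
| ExLoopS r p s n t s' t' s'' : s r = n.+1 -> exec p (upd s r n) t s' ->
    exec (Loop r p) s' t' s'' -> exec (Loop r p) s (1 + t + t') s''.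

(** The time is forgotten: for the compiled function only termination matters, while exact times are
    kept for the membership test. *)
Definition executes p s s' := exists t, exec p s t s'.

Lemma executes_Nop s : executes Nop s s. Proof. by exists 1; constructor. Qed.

Lemma executes_Inc r s : executes (Inc r) s (upd s r (s r).+1).
Proof. by exists 1; constructor. Qed.

Lemma executes_Seq p q s s' s'' : executes p s s' -> executes q s' s'' -> executes (Seq p q) s s''.
Proof. by move=> [t pt] [t' qt]; exists (t + t'); apply: ExSeq pt qt. Qed.

Lemma executes_Loop0 r p s : s r = 0 -> executes (Loop r p) s s.
Proof. by exists 1; constructor. Qed.

Lemma executes_LoopS r p s n s' s'' : s r = n.+1 -> executes p (upd s r n) s' ->
  executes (Loop r p) s' s'' -> executes (Loop r p) s s''.
Proof. by move=> sr [t pt] [t' qt]; exists (1 + t + t'); apply: ExLoopS sr pt qt. Qed.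

Definition clear r := Loop r Nop.

Lemma executes_clear r s : executes (clear r) s (upd s r 0).
Proof.
move Dn: (s r) => n; elim: n s Dn => [|n IHn] s Dn.
  by rewrite -Dn upd_id; apply: executes_Loop0.
apply: executes_LoopS Dn (executes_Nop _) _.
by have := IHn (upd s r n) (updE _ _ _); rewrite upd_upd.
Qed.

Definition move r o := Loop r (Inc o).

Lemma executes_move r o s : r != o -> executes (move r o) s (upd (upd s r 0) o (s o + s r)).
Proof.
move=> ro; move Dn: (s r) => n; elim: n s Dn => [|n IHn] s Dn.
  by rewrite addn0 -Dn upd_id upd_id; apply: executes_Loop0.
apply: executes_LoopS Dn (executes_Inc _ _) _.
have := IHn (upd (upd s r n) o (upd s r n o).+1).
rewrite updN // !updE => /(_ erefl).
by rewrite updN 1?eq_sym // [in X in _ -> X]addnS -addSn -(updC _ _ _ ro) !upd_upd.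
Qed.

(** Reading a register destroys it; the auxiliary register [u] restores it. *)
Definition copy r o u := Seq (Loop r (Seq (Inc o) (Inc u))) (move u r).

Lemma executes_copy r o u s : r != o -> r != u -> o != u -> s u = 0 ->
  executes (copy r o u) s (upd s o (s o + s r)).
Proof.
move=> ro ru ou su.
have H n s0 : s0 r = n ->
    executes (Loop r (Seq (Inc o) (Inc u))) s0 (upd (upd (upd s0 r 0) o (s0 o + n)) u (s0 u + n)).
  elim: n s0 => [|n IHn] s0 Dn.
    by rewrite !addn0 -{1}Dn !upd_id; apply: executes_Loop0.
  apply: executes_LoopS Dn (executes_Seq (executes_Inc _ _) (executes_Inc _ _)) _.
  set s1 := upd _ u _.
  have -> : upd (upd (upd s0 r 0) o (s0 o + n.+1)) u (s0 u + n.+1) =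
            upd (upd (upd s1 r 0) o (s1 o + n)) u (s1 u + n).
    by apply: funext => i; rewrite /s1 /upd !eqxx; do !case: eqVneq => ?; subst; rewrite ?eqxx in ru ro ou *; lia.
  by apply: IHn; rewrite /s1 /upd (negPf ru) (negPf ro) eqxx.
apply: executes_Seq (H _ _ erefl) _; set s1 := upd _ u _.
have -> : upd s o (s o + s r) = upd (upd s1 u 0) r (s1 r + s1 u).
  by apply: funext => i; rewrite /s1 /upd !eqxx; do !case: eqVneq => ?; subst; rewrite ?eqxx in ru ro ou *; lia.
by apply: executes_move; rewrite eq_sym.
Qed.

(** Calling convention: the arguments are in the registers [a], the result goes to [o], which starts
    at 0, and the registers from [b] on are scratch, zero before and after. In [RPrec], [b] counts
    the remaining rounds, [b.+1] is the index, [b.+2] receives the new value and [o] holds the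
    current one. In [RMin], [o] is the candidate and [b] the value there. *)
Fixpoint compile n (c : recfun n) (a : seq nat) (o b : nat) : prog :=
  match c with
  | RZero _ => Nop
  | RSucc => Seq (copy (head 0 a) o b) (Inc o)
  | RProj _ i => copy (nth 0 a i) o b
  | RComp m _ f g =>
      Seq (foldr (fun i : 'I_m => Seq (compile (g i) a (b + i) (b + m))) Nop (enum 'I_m))
     (Seq (compile f (iota b m) o (b + m))
          (foldr (fun r => Seq (clear r)) Nop (iota b m)))
  | RPrec _ f g =>
      Seq (copy (head 0 a) b b.+1)
     (Seq (compile f (behead a) o b.+3)
     (Seq (Loop b
            (Seq (compile g [:: b.+1, o & behead a] b.+2 b.+3)
            (Seq (clear o) (Seq (move b.+2 o) (Inc b.+1)))))
          (clear b.+1)))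
  | RMin _ f =>
      Seq (compile f (o :: a) b b.+1)
          (Loop b (Seq (clear b) (Seq (Inc o) (compile f (o :: a) b b.+1))))
  end.

Lemma executes_clears l s : executes (foldr (fun r => Seq (clear r)) Nop l) s
  (fun r => if r \in l then 0 else s r).
Proof.
elim: l s => [|r l IHl] s /=; first exact: executes_Nop.
apply: executes_Seq (executes_clear _ _) _; have := IHl (upd s r 0).
congr executes; apply: funext => i; rewrite in_cons /upd.
by case: (i == r) => //=; case: ifP.
Qed.

Lemma map_upd s r v a : r \notin a -> map (upd s r v) a = map s a.
Proof.
move=> ra; apply/eq_in_map => i ia; rewrite updN //.
by apply: contraNneq ra => <-.
Qed.

Lemma notin_lt a b r : all (ltn^~ b) a -> b <= r -> r \notin a.
Proof. by move=> /allP ab br; apply/negP => /ab /=; rewrite ltnNge br. Qed.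

Definition upds m b (ys : m.-tuple nat) (l : seq 'I_m) s :=
  foldl (fun s (i : 'I_m) => upd s (b + i) (tnth ys i)) s l.

Lemma updsN m b (ys : m.-tuple nat) (l : seq 'I_m) s r :
  (forall i, i \in l -> r != b + i) -> upds b ys l s r = s r.
Proof.
rewrite /upds; elim: l s => //= i l IHl s ril.
rewrite IHl => [|j jl]; first by rewrite updN // ril ?mem_head.
by rewrite ril // in_cons jl orbT.
Qed.

Lemma updsE m b (ys : m.-tuple nat) (l : seq 'I_m) s i :
  uniq l -> i \in l -> upds b ys l s (b + i) = tnth ys i.
Proof.
elim: l s => //= j l IHl s /andP[jl ul]; rewrite in_cons => /predU1P[->|]; last exact: IHl.
rewrite -/(upds b ys l _) updsN ?updE // => k kl.
by rewrite eqn_add2l; apply: contraNneq jl => /val_inj->.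
Qed.

(** The conclusion describes the whole final state: arguments and scratch are as before. This is
    what allows compiled pieces to be chained in the induction on [c]. *)
Lemma executes_compile n (c : recfun n) (xs : n.-tuple nat) y a o b s :
  rec_graph c xs y -> map s a = xs -> all (ltn^~ b) a -> o < b -> o \notin a ->
  (forall r, b <= r -> s r = 0) -> s o = 0 ->
  executes (compile c a o b) s (upd s o y).
Proof.
elim: c xs y a o b s => {n} [n||n i|m n f IHf g IHg|n f IHf g IHg|n f IHf] xs y a o b s /=.
- by move=> -> _ _ _ _ _ so; rewrite -so upd_id; apply: executes_Nop.
- move=> -> Dxs ab ob oa sb so.
  have : size a = 1 by rewrite -(size_map s) Dxs size_tuple.
  case: a Dxs ab oa => [|r [|? ?]] //= Dxs /andP[rb _]; rewrite inE => or _.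
  have Dr : thead xs = s r by rewrite /thead (tnth_nth 0) -Dxs.
  have := executes_copy (s := s) (r := r) (o := o) (u := b).
  rewrite eq_sym or (ltn_eqF rb) (ltn_eqF ob) sb // => /(_ isT isT isT erefl) H.
  apply: executes_Seq H _; have := executes_Inc o (upd s o (s o + s r)).
  by rewrite updE upd_upd so -Dr.
- move=> -> Dxs ab ob oa sb so.
  have sza : size a = n by rewrite -(size_map s) Dxs size_tuple.
  have ia : nth 0 a i \in a by rewrite mem_nth // sza.
  have -> : tnth xs i = s o + s (nth 0 a i).
    by rewrite so (tnth_nth 0) -Dxs (nth_map 0) // sza.
  apply: executes_copy; rewrite ?sb //.
  + by apply: contraNneq oa => <-.
  + by rewrite neq_ltn (allP ab _ ia).
  + by rewrite neq_ltn ob.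
- move=> [ys [gys fy]] Dxs ab ob oa sb so.
  (* Generalized over the list [l] of inner functions still to be run: the result of [g i] goes to
     [b + i], scratch starts at [b + m], and the targets not yet filled are 0. *)
  have H (l : seq 'I_m) s0 : uniq l -> map s0 a = xs -> (forall r, b + m <= r -> s0 r = 0) ->
      (forall i, i \in l -> s0 (b + i) = 0) ->
      executes (foldr (fun i : 'I_m => Seq (compile (g i) a (b + i) (b + m))) Nop l) s0 (upds b ys l s0).
    elim: l s0 => [|i l IHl] s0 /=; first by move=> *; apply: executes_Nop.
    move=> /andP[il ul] Dxs0 sb0 sl0; apply: executes_Seq (IHg i xs (tnth ys i) _ _ _ _ _ _ _ _ _ _ _) _ => //.
    + by apply: sub_all ab => r /= /leq_trans -> //; apply: leq_addr.
    + by rewrite ltn_add2l.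
    + by apply: notin_lt ab _; apply: leq_addr.
    + by apply: sl0; apply: mem_head.
    apply: IHl => // [|r br|j jl].
    + by rewrite map_upd //; apply: notin_lt ab _; apply: leq_addr.
    + by rewrite updN ?sb0 //; apply: contraTneq br => ->; rewrite -ltnNge ltn_add2l.
    + rewrite updN ?sl0 ?in_cons ?jl ?orbT // eqn_add2l.
      by apply: contraNneq il => /val_inj <-.
  apply: executes_Seq (H _ _ (enum_uniq _) Dxs _ _) _ => [r br|i _|].
  + by apply: sb; apply: leq_trans br; apply: leq_addr.
  + by apply: sb; apply: leq_addr.
  set s1 := upds _ _ _ _.
  have s1lo r : r < b -> s1 r = s r.
    by move=> rb; apply: updsN => i _; rewrite neq_ltn (leq_trans rb) // leq_addr.
  have s1hi r : b + m <= r -> s1 r = 0.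
    move=> br; rewrite -(sb r); last by apply: leq_trans br; apply: leq_addr.
    by apply: updsN => i _; rewrite neq_ltn (leq_trans _ br) ?ltn_add2l ?orbT.
  have s1y (i : 'I_m) : s1 (b + i) = tnth ys i by apply: updsE; rewrite ?enum_uniq ?mem_enum.
  apply: executes_Seq (IHf _ _ _ _ _ _ fy _ _ _ _ _ _) _ => //.
  + apply: (@eq_from_nth _ 0); rewrite size_map size_iota ?size_tuple // => i im.
    by rewrite (nth_map 0) ?size_iota // nth_iota // (s1y (Ordinal im)) (tnth_nth 0).
  + by apply/allP => r; rewrite mem_iota /= => /andP[].
  + by rewrite (leq_trans ob) // leq_addr.
  + by rewrite mem_iota negb_and -ltnNge ob.
  + by rewrite s1lo.
  have := executes_clears (iota b m) (upd s1 o y); congr executes; apply: funext => r.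
  rewrite mem_iota; case: (ltnP r b) => [rb|br] /=.
    by rewrite /upd s1lo.
  rewrite !updN ?sb //; try by rewrite neq_ltn (leq_trans ob br) orbT.
  by case: ltnP => // /s1hi.
- move=> [h [h0 hS ->]]; case: a => [|r a]; first by case: xs {h0 hS} => -[].
  move=> Dxs /= /andP[rb ab] ob; rewrite in_cons negb_or => /andP[or oa] sb so.
  have Da : map s a = [tuple of behead xs] by rewrite /= -Dxs.
  have Dr : thead xs = s r by rewrite /thead (tnth_nth 0) -Dxs.
  have sb0 := sb b (leqnn _); have sb1 := sb b.+1 (leqW (leqnn _)).
  have ba : b \notin a by apply: notin_lt ab _.
  have b1a : b.+1 \notin a by apply: notin_lt ab (leqW _).
  have ab3 : all (ltn^~ b.+3) a by apply: sub_all ab => i /= ib; rewrite (leq_trans ib) // ?leqW.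
  apply: executes_Seq (executes_copy _ _ _ _) _ => //; try by lia.
  rewrite sb0 add0n -Dr; set x := thead xs.
  apply: executes_Seq (IHf _ _ _ _ _ _ h0 _ _ _ _ _ _) _ => //; try by lia.
  + by rewrite map_upd.
  + by move=> i ib; rewrite updN ?sb //; lia.
  + by rewrite updN //; lia.
  (* The state before round [j]: [x - j] rounds remain, the index is [j], and [o] holds [h j]. *)
  pose S j := upd (upd (upd s b (x - j)) b.+1 j) o (h j).
  have H k j : j + k = x ->
      executes (Loop b (Seq (compile g [:: b.+1, o & a] b.+2 b.+3)
            (Seq (clear o) (Seq (move b.+2 o) (Inc b.+1))))) (S j) (S x).
    elim: k j => [|k IHk] j jk.
      rewrite -jk addn0; apply: executes_Loop0; rewrite /S /upd.
      by do !case: eqVneq => ?; lia.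
    have Sjb : S j b = k.+1.
      by rewrite /S /upd; do !case: eqVneq => ?; lia.
    apply: executes_LoopS Sjb _ (IHk j.+1 _); last by lia.
    set s1 := upd (S j) b k.
    apply: executes_Seq (IHg _ (h j.+1) _ _ _ _ (hS j _) _ _ _ _ _ _) _; first by rewrite -/x; lia.
    + rewrite /= -Da /s1 /S !map_upd //; congr [:: _, _ & _].
        by rewrite /upd !eqxx /=; do !case: eqVneq => ?; lia.
      by rewrite /upd !eqxx /=; case: eqVneq => ?; lia.
    + by rewrite /= ab3; lia.
    + by lia.
    + by rewrite !in_cons !negb_or (notin_lt ab (leqW (leqW (leqnn _)))); lia.
    + by move=> i ib; rewrite /s1 /S /upd; do !case: eqVneq => ?; rewrite ?sb //; lia.
    + by rewrite /s1 /S /upd; do !case: eqVneq => ?; rewrite ?sb //; lia.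
    set s2 := upd s1 _ _.
    apply: executes_Seq (executes_clear _ _) (executes_Seq (executes_move _ _) _); first by lia.
    have := executes_Inc b.+1 (upd (upd (upd s2 o 0) b.+2 0) o (upd s2 o 0 o + upd s2 o 0 b.+2)).
    have sb2 := sb b.+2 (leqW (leqW (leqnn _))).
    congr executes; apply: funext => i; rewrite /s2 /s1 /S /upd !eqxx.
    by do !case: eqVneq => ?; subst; rewrite ?sb0 ?sb1 ?sb2 //; lia.
  have H1 := H x 0 (add0n _).
  have -> : upd (upd s b x) o (h 0) = S 0.
    apply: funext => i; rewrite /S /upd subn0.
    by do !case: eqVneq => ?; subst; rewrite ?sb0 ?sb1 //; lia.
  apply: executes_Seq H1 _; have := executes_clear b.+1 (S x).
  congr executes; apply: funext => i; rewrite /S /upd.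
  by do !case: eqVneq => ?; subst; rewrite ?sb0 ?sb1 //; lia.
- move=> [fy miny] Dxs ab ob oa sb so.
  (* The values of [f] at all candidates up to [y], collected in one function: positive below [y],
     zero at [y]. *)
  have [v [vy vS]] : exists v : nat -> nat, v y = 0 /\ forall z, z < y -> 
      rec_graph f [tuple of z :: xs] (v z) /\ 0 < v z.
    have /choice[v Hv] : forall z, exists v, (z < y -> rec_graph f [tuple of z :: xs] v.+1).
      move=> z; case: (boolP (z < y)) => [/miny[v fv]|_]; first by exists v.
      by exists 0.
    exists (fun z => if z < y then (v z).+1 else 0); rewrite ltnn; split=> // z zy.
    by rewrite zy; split=> //; apply: Hv.
  have vP z : z <= y -> rec_graph f [tuple of z :: xs] (v z).
    by rewrite leq_eqVlt => /predU1P[->|/vS[]//]; rewrite vy.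
  have sb0 := sb b (leqnn _).
  have ab1 : all (ltn^~ b.+1) a by apply: sub_all ab => i; apply: leqW.
  have ba : b \notin a by apply: notin_lt ab _.
  have Hf z : z <= y ->
      executes (compile f (o :: a) b b.+1) (upd s o z) (upd (upd s o z) b (v z)).
    move=> zy; apply: (IHf [tuple of z :: xs]) => //.
    + exact: vP.
    + by rewrite /= map_upd // updE Dxs.
    + by rewrite /= ab1; lia.
    + by rewrite in_cons negb_or ba; lia.
    + by move=> r br; rewrite updN ?sb //; lia.
    + by rewrite updN ?sb //; lia.
  have s0 : upd s o 0 = s by rewrite -so upd_id.
  apply: (@executes_Seq _ _ _ (upd (upd s o 0) b (v 0))).
    by have := Hf 0 (leq0n _); rewrite s0.
  (* Loop invariant with [k] candidates to go: [o] holds [z], and [b] holds the value there, which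
     is zero only when [z] is [y]. *)
  suff H k z : z + k = y ->
      executes (Loop b (Seq (clear b) (Seq (Inc o) (compile f (o :: a) b b.+1))))
         (upd (upd s o z) b (v z)) (upd s o y) by apply: (H y 0).
  elim: k z => [|k IHk] z zk.
    have -> : z = y by lia.
    rewrite vy; have -> : upd (upd s o y) b 0 = upd s o y.
      by apply: funext => i; rewrite /upd; do !case: eqVneq => ?; subst; rewrite ?sb0 //; lia.
    by apply: executes_Loop0; rewrite updN ?sb //; lia.
  have [|_ vz] := vS z; first by lia.
  have Hv : upd (upd s o z) b (v z) b = (v z).-1.+1 by rewrite updE prednK.
  apply: executes_LoopS Hv _ (IHk z.+1 _); last by lia.
  apply: executes_Seq (executes_clear _ _) (executes_Seq (executes_Inc _ _) _).
  set s1 := upd _ o _.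
  have -> : s1 = upd s o z.+1.
    apply: funext => i; rewrite /s1 /upd eqxx.
    by do !case: eqVneq => ?; subst; rewrite ?sb0 //; lia.
  by apply: Hf; lia.
Qed.

(** * From counter programs to Turing machines *)

(** Each instruction changes at most one register, and by at most one, so that a single machine step
    can carry it out. *)
Inductive instr := INop of nat | IInc of nat & nat | IDjz of nat & nat & nat.

Definition exec_instr (i : instr) (s : nat -> nat) : nat * (nat -> nat) :=
  match i with
  | INop k => (k, s)
  | IInc r k => (k, upd s r (s r).+1)
  | IDjz r k k0 => if s r == 0 then (k0, s) else (k, upd s r (s r).-1)
  end.

Definition cstep (tab : nat -> instr) (c : nat * (nat -> nat)) := exec_instr (tab c.1) c.2.

Fixpoint len p :=
  match p with
  | Seq p q => len p + len q
  | Loop _ p => (len p).+1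
  | _ => 1
  end.

(* The code of [p] occupies the addresses from [a] to [a + len p - 1] and
   continues at [k]. *)
Fixpoint flat p a k (pc : nat) : instr :=
  match p with
  | Nop => INop k
  | Inc r => IInc r k
  | Dec r => IDjz r k k
  | Seq p q => if pc < a + len p then flat p a (a + len p) pc
               else flat q (a + len p) k pc
  | Loop r p => if pc == a then IDjz r a.+1 k else flat p a.+1 a pc
  end.

(** [P] constrains the address strictly before time [t]. It is used to show that address 2 is not
    met between events and that the machine does not halt during the test. *)
Definition runs (P : pred nat) tab c t c' :=
  iter t (cstep tab) c = c' /\ forall i, i < t -> P (iter i (cstep tab) c).1.

Lemma runs0 P tab c : runs P tab c 0 c.
Proof. by []. Qed.

Lemma runs1 (P : pred nat) tab c : P c.1 -> runs P tab c 1 (cstep tab c).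
Proof. by move=> Pc; split=> // -[]. Qed.

Lemma runs_trans P tab c t c' t' c'' :
  runs P tab c t c' -> runs P tab c' t' c'' -> runs P tab c (t + t') c''.
Proof.
move=> [E Pt] [E' Pt']; split=> [|i lti]; first by rewrite addnC iterD E.
case: (ltnP i t) => [/Pt //|le_ti].
by rewrite -(subnK le_ti) iterD E; apply: Pt'; lia.
Qed.

Lemma runsW (P Q : pred nat) tab c t c' :
  (forall pc, P pc -> Q pc) -> runs P tab c t c' -> runs Q tab c t c'.
Proof. by move=> PQ [E Pt]; split=> // i /Pt /PQ. Qed.

Lemma len_gt0 p : 0 < len p.
Proof. by elim: p => //= p ? q ?; rewrite addn_gt0; apply/orP; left. Qed.

(** The times in [exec] are chosen to be exact here: every loop test costs one step, also the
    failing one, and sequencing is free because each piece jumps straight to its continuation. *)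
Lemma exec_flat p s t s' tab a k : exec p s t s' ->
  (forall pc, a <= pc < a + len p -> tab pc = flat p a k pc) ->
  runs (fun pc => a <= pc < a + len p) tab (a, s) t (k, s').
Proof.
move=> H; elim: H a k => {p s t s'} [s|r s|r s|p q s t s' t' s'' _ IHp _ IHq|r p s sr|r p s n t s' t' s'' sr _ IHp _ IHl] a k Ht /=.
- have -> : (k, s) = cstep tab (a, s) by rewrite /cstep Ht //= addn1 leqnn ltnS leqnn.
  by apply: runs1 => /=; lia.
- have -> : (k, upd s r (s r).+1) = cstep tab (a, s) by rewrite /cstep Ht //=; lia.
  by apply: runs1 => /=; lia.
- have -> : (k, upd s r (s r).-1) = cstep tab (a, s).
    rewrite /cstep Ht /=; last by lia.
    by case: eqP => // sr; rewrite sr /= -sr upd_id.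
  by apply: runs1 => /=; lia.
- have Hp := len_gt0 p; have Hq := len_gt0 q.
  apply: (@runs_trans _ _ _ _ (a + len p, s')).
    apply: runsW (IHp a (a + len p) _) => [pc|pc Hpc]; first by lia.
    by rewrite Ht /= ?ifT //; lia.
  apply: runsW (IHq (a + len p) k _) => [pc|pc Hpc]; first by lia.
  by rewrite Ht /= ?ifF //; lia.
- have -> : (k, s) = cstep tab (a, s).
    by rewrite /cstep Ht /= ?eqxx /= ?sr //=; lia.
  by apply: runs1 => /=; lia.
- apply: (@runs_trans _ _ _ _ (a, s')); last exact: IHl.
  apply: (@runs_trans _ _ _ _ (a.+1, upd s r n)).
    have -> : (a.+1, upd s r n) = cstep tab (a, s).
      by rewrite /cstep Ht /= ?eqxx /= ?sr //=; lia.
    by apply: runs1 => /=; lia.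
  apply: runsW (IHp a.+1 a _) => [pc|pc Hpc]; first by lia.
  by rewrite Ht /= ?ifF //; lia.
Qed.

Definition reg_lt K (i : instr) :=
  match i with INop _ => true | IInc r _ | IDjz r _ _ => r < K end.

Fixpoint bound p :=
  match p with
  | Nop => 0
  | Inc r | Dec r => r.+1
  | Seq p q => maxn (bound p) (bound q)
  | Loop r p => maxn r.+1 (bound p)
  end.

Lemma reg_lt_flat p K a k pc : bound p <= K -> reg_lt K (flat p a k pc).
Proof.
elim: p a k => //= [p IHp q IHq|r p IHp] a k; rewrite geq_max => /andP[Hp Hq].
  by case: ifP => _; auto.
by case: ifP => _ //=; auto.
Qed.

Lemma cstep_le tab c r : (cstep tab c).2 r <= (c.2 r).+1.
Proof.
rewrite /cstep; case: (tab c.1) => [k|q k|q k k0] /=; rewrite /upd //.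
  by case: eqP => [->|] //=.
by case: ifP => //= _; case: eqP => [->|] /=; lia.
Qed.

(** Applied at a time equal to the input length, this bounds the number that the membership test has
    to halve. *)
Lemma iter_cstep_le tab c t r : (iter t (cstep tab) c).2 r <= c.2 r + t.
Proof.
elim: t => [|t IHt]; rewrite ?addn0 // iterS addnS.
exact: leq_trans (cstep_le _ _ _) _.
Qed.

(* A tape holding the counter value [n]: the mark 1 is [n] cells to the left of
   the head, and [j] blanks to the right have been visited. *)
Definition counter_tape n j :=
  Tape (if n is m.+1 then rcons (nseq m 0) 1 else [::]) (n == 0) (nseq j 0).

Definition work K (s j : nat -> nat) := [seq counter_tape (s i) (j i) | i <- iota 0 K].

(** By the layout of counter tapes, these are the symbols under the work heads. *)
Definition marks K (s : nat -> nat) : seq nat := [seq nat_of_bool (s i == 0) | i <- iota 0 K].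

Definition tape_move (i : instr) (v : seq nat) (r : nat) :=
  match i with
  | INop _ => Stay
  | IInc q _ => if r == q then Right else Stay
  | IDjz q _ _ => if (r == q) && (nth 0 v q == 0) then Left else Stay
  end.

Definition next_pc (i : instr) (v : seq nat) :=
  match i with
  | INop k => k
  | IInc _ k => k
  | IDjz q k k0 => if nth 0 v q == 0 then k else k0
  end.

Definition counter_actions K i v :=
  [seq Action (nth 0 v r) (nth 0 v r) (tape_move i v r) | r <- iota 0 K].

Definition tm_rule K pc i a d v :=
  Rule pc (next_pc i v) (Action a a d :: counter_actions K i v).

Lemma nth_marks K s r : r < K -> nth 0 (marks K s) r = (s r == 0).
Proof. by move=> rK; rewrite (nth_map 0) ?size_iota // nth_iota. Qed.

Lemma size_marks K s : size (marks K s) = K.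
Proof. by rewrite size_map size_iota. Qed.

Lemma next_pc_marks K i s : reg_lt K i -> next_pc i (marks K s) = (exec_instr i s).1.
Proof.
case: i => //= q k k0 qK; rewrite nth_marks //.
by case: (s q == 0).
Qed.

Lemma zip_map_same (S T U : Type) (f : S -> T) (g : S -> U) s :
  zip (map f s) (map g s) = [seq (f x, g x) | x <- s].
Proof. by elim: s => //= x s ->. Qed.

(** The number of blanks listed explicitly on the right depends on the history of moves and is
    irrelevant to the counter, hence existential. *)
Lemma act_counter_right n j : exists j',
  act (Action (n == 0) (n == 0) Right) (counter_tape n j) = counter_tape n.+1 j'.
Proof.
exists j.-1; rewrite /act /counter_tape /=.
by case: n j => [|n] [|j].
Qed.

Lemma act_counter_left n j : exists j',
  act (Action 0 0 Left) (counter_tape n.+1 j) = counter_tape n j'.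
Proof. by exists j.+1; rewrite /act /counter_tape /=; case: n. Qed.

Lemma act_counter_stay n j :
  act (Action (n == 0) (n == 0) Stay) (counter_tape n j) = counter_tape n j.
Proof. by []. Qed.

Lemma act_work K i s j : reg_lt K i -> exists j',
  [seq act p.1 p.2 | p <- zip (counter_actions K i (marks K s)) (work K s j)] =
  work K (exec_instr i s).2 j'.
Proof.
move=> iK.
suff /choice[j' Hj'] : forall r, exists j', r < K ->
    act (Action (nth 0 (marks K s) r) (nth 0 (marks K s) r) (tape_move i (marks K s) r))
        (counter_tape (s r) (j r)) = counter_tape ((exec_instr i s).2 r) j'.
  exists j'; rewrite zip_map_same -map_comp; apply/eq_in_map => r.
  by rewrite mem_iota /= add0n => /Hj'.
move=> r; case: (ltnP r K) => [rK|_]; last by exists 0.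
rewrite nth_marks //; case: i iK => [k|q k|q k k0] qK /=.
- by exists (j r) => _; apply: act_counter_stay.
- case: eqVneq => [->|rq].
    by have [j' Hj'] := act_counter_right (s q) (j q); exists j'; rewrite updE.
  by exists (j r); rewrite updN.
- rewrite nth_marks //; case: (eqVneq r q) => [->|rq] /=; last first.
    exists (j r) => _; rewrite -[LHS]/(counter_tape (s r) (j r)).
    by case: (s q == 0); rewrite //= /upd (negPf rq).
  case Dq: (s q) => [|n] /=; first by exists (j q) => _; rewrite Dq.
  by have [j' Hj'] := act_counter_left n (j q); exists j'; rewrite updE.
Qed.

Lemma reads_counter K i v : size v = K -> map reads (counter_actions K i v) = v.
Proof. by move=> <-; rewrite -map_comp; apply: mkseq_nth. Qed.

Lemma scanned_work K s j : map scanned (work K s j) = marks K s.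
Proof. by rewrite -map_comp. Qed.

(** * Machine steps that simulate counter steps *)

HB.instance Definition _ := gen_eqMixin rule.

(** With only one applicable rule, its place in the list does not matter. *)
Lemma step_rule M c r : r \in rules M -> applicable c r ->
  (forall r', r' \in rules M -> applicable c r' -> r' = r) ->
  step M c = apply_rule r c.
Proof.
move=> rM cr ur; rewrite /step.
have : r \in [seq r <- rules M | applicable c r] by rewrite mem_filter cr.
case Df: [seq _ <- _ | _] => [//|r' s] _.
have : r' \in [seq r <- rules M | applicable c r] by rewrite Df mem_head.
by rewrite mem_filter => /andP[cr' /ur->].
Qed.

Definition counter_config K (c : nat * (nat -> nat)) t j := Config c.1 (t :: work K c.2 j).

Lemma applicable_tm_rule K pc i a d v c t j : size v = K ->
  applicable (counter_config K c t j) (tm_rule K pc i a d v) =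
  [&& pc == c.1, a == scanned t & v == marks K c.2].
Proof.
by move=> sv; rewrite /applicable /= eqseq_cons reads_counter // scanned_work.
Qed.

Lemma step_counter M K tab c t j d :
  reg_lt K (tab c.1) ->
  tm_rule K c.1 (tab c.1) (scanned t) d (marks K c.2) \in rules M ->
  (forall r, r \in rules M -> applicable (counter_config K c t j) r ->
     exists2 v, size v = K & r = tm_rule K c.1 (tab c.1) (scanned t) d v) ->
  exists j', step M (counter_config K c t j) =
    counter_config K (cstep tab c) (act (Action (scanned t) (scanned t) d) t) j'.
Proof.
move=> cK rM ur; have [j' Hj'] := act_work c.2 j cK; exists j'.
rewrite (@step_rule _ _ _ rM) ?applicable_tm_rule ?size_marks ?eqxx //.
  by rewrite /apply_rule /= Hj' /counter_config /cstep -(@next_pc_marks K).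
move=> r' /ur H cr'; have [v sv Dr'] := H cr'.
by move: cr'; rewrite Dr' applicable_tm_rule // => /and3P[_ _ /eqP->].
Qed.

(** * The event machine *)

Fixpoint bitvecs K : seq (seq nat) :=
  if K is K.+1 then [seq b :: v | b <- [:: 0; 1], v <- bitvecs K] else [:: [::]].

Lemma size_bitvecs K v : v \in bitvecs K -> size v = K.
Proof.
by elim: K v => [|K IHK] v; [rewrite inE => /eqP-> | case/allpairsP=> -[b u] [_ /IHK <- ->]].
Qed.

Lemma marks_bitvecs K s : marks K s \in bitvecs K.
Proof.
have: marks K s \in bitvecs (size (iota 0 K)); last by rewrite size_iota.
rewrite /marks; elim: (iota 0 K) => [//|r l IHl].
by apply: (allpairs_f cons) => //; case: (s r == 0).
Qed.

(** A rule names the symbol read on every tape, so each address needs one copy per input symbol in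
    [ss] and per vector of work symbols; [d] is the move of the input head. *)
Definition tm_rules K (tab : nat -> instr) (D ss : seq nat) d :=
  flatten [seq [seq tm_rule K pc (tab pc) p.1 d p.2 | p <- allpairs pair ss (bitvecs K)] | pc <- D].

Lemma tm_rulesP K tab D ss d r :
  reflect (exists pc a v, [/\ pc \in D, a \in ss, v \in bitvecs K & r = tm_rule K pc (tab pc) a d v])
    (r \in tm_rules K tab D ss d).
Proof.
apply: (iffP flatten_mapP) => [[pc pcD /mapP[p /allpairsP[[a v] [/= ass vK ->]] ->]]|].
  by exists pc, a, v.
move=> [pc [a [v [pcD ass vK ->]]]]; exists pc => //; apply/mapP; exists (a, v) => //.
by apply/allpairsP; exists (a, v).
Qed.

(** At least 4, because the test works on registers 1 to 3. *)
Definition work_registers pG := maxn 4 (bound pG).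
Definition cleanup := Seq (clear 1) (Inc 0).
(** Each inner round takes two units from register 1, one by the loop test and one by [Dec]; as
    [Dec] is truncated at 0, halves are rounded up. Register 2 says how often to halve. *)
Definition halvings := Loop 2 (Seq (Loop 1 (Seq (Dec 1) (Inc 3))) (move 3 1)).

(* Address 2 signals that register 1 holds [G j], where [j] is in register 0. *)
Definition main_table pG pc :=
  if pc == 2 then INop 3 else if pc < 6 then flat cleanup 3 6 pc else flat pG 6 2 pc.
Definition main_dom pG := iota 2 (4 + len pG).

Definition test_addr pG := 6 + len pG.
(** The chain from [b + 9] loads [x] into register 2; then come the halvings at [b]. Addresses
    [b + 6] and [b + 7] alternate while register 1 is counted down: an even value exits to the
    accepting state 1, an odd one to [b + 8], which has no rule. *)
Definition test_table pG x pc :=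
  let b := test_addr pG in
  if pc == 2 then INop (b + 9)
  else if pc < b + 6 then flat halvings b (b + 6) pc
  else if pc == b + 6 then IDjz 1 (b + 7) 1
  else if pc == b + 7 then IDjz 1 (b + 6) (b + 8)
  else if pc < b + 9 + x then IInc 2 pc.+1 else INop b.
Definition test_dom pG x := 2 :: iota (test_addr pG) 8 ++ iota (test_addr pG + 9) x.+1.

(** The 1 written on every work tape is the mark of a counter at zero; address 6 is the entry of
    [pG]. *)
Definition start_rule K a := Rule 0 6 (Action a a Stay :: nseq K (Action 0 1 Stay)).

(* The main table is run while the input head sweeps over the input, one cell
   per step; the blank at the end of the input switches to the test table. *)
Definition event_machine pG x :=
  let K := work_registers pG in
  Machine K (map (start_rule K) [:: 0; 1; 2] ++
    tm_rules K (main_table pG) (main_dom pG) [:: 1; 2] Right ++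
    tm_rules K (test_table pG x) (test_dom pG x) [:: 0] Stay).

Definition right t := Tape (scanned t :: lcells t) (head 0 (rcells t)) (behead (rcells t)).

Lemma scanned_iter_right t i : scanned (iter i right t) = nth 0 (scanned t :: rcells t) i.
Proof.
elim: i t => [|i IHi] t //; rewrite iterSr IHi /=.
by case: (rcells t) i {IHi} => [|? ?] [] //= i; rewrite nth_nil.
Qed.

Lemma scanned_input w i :
  scanned (iter i right (input_tape w)) = nth 0 [seq (nat_of_bool b).+1 | b <- w] i.
Proof. by rewrite scanned_iter_right /=; case: w i => [|b w] [|[]]. Qed.

Definition main_run pG i := iter i (cstep (main_table pG)) (6, fun=> 0).

Lemma reg_lt_main pG pc : reg_lt (work_registers pG) (main_table pG pc).
Proof.
rewrite /main_table; case: ifP => // _; case: ifP => _; apply: reg_lt_flat.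
  by rewrite /= leq_max.
exact: leq_maxr.
Qed.

Lemma reg_lt_test pG x pc : reg_lt (work_registers pG) (test_table pG x pc).
Proof.
have le4 : 4 <= work_registers pG by apply: leq_maxl.
rewrite /test_table; by do !case: ifP => _ //=; try exact: leq_trans le4; apply: reg_lt_flat.
Qed.

Lemma main_dom_gt1 pG pc : pc \in main_dom pG -> 1 < pc.
Proof. by rewrite mem_iota => /andP[]. Qed.

Lemma test_dom_gt1 pG x pc : pc \in test_dom pG x -> 1 < pc.
Proof. by rewrite /test_addr in_cons mem_cat !mem_iota /test_addr; lia. Qed.

Lemma event_machine_rules pG x r (K := work_registers pG) :
  (r \in rules (event_machine pG x)) =
  [|| r \in map (start_rule K) [:: 0; 1; 2],
      r \in tm_rules K (main_table pG) (main_dom pG) [:: 1; 2] Right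
    | r \in tm_rules K (test_table pG x) (test_dom pG x) [:: 0] Stay].
Proof. exact: etrans (mem_cat _ _ _) (congr1 (orb _) (mem_cat _ _ _)). Qed.

Lemma start_step pG x w : exists j,
  step (event_machine pG x) (init (event_machine pG x) w) =
  counter_config (work_registers pG) (main_run pG 0) (input_tape w) j.
Proof.
exists (fun=> 0); set K := work_registers pG; set c := init _ _.
have sc : map scanned (tapes c) = scanned (input_tape w) :: nseq K 0.
  by rewrite /= map_nseq.
have Hr : start_rule K (scanned (input_tape w)) \in rules (event_machine pG x).
  rewrite event_machine_rules; apply/orP; left; apply: map_f.
  by rewrite /input_tape /=; case: w {c sc} => [|[] w].
have rd a : map reads (actions (start_rule K a)) = a :: nseq K 0.
  by rewrite /= map_nseq.
rewrite (@step_rule _ _ _ Hr).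
- rewrite /apply_rule /counter_config [tapes _]/= [actions _]/= [zip _ _]/= [map _ _]/=.
  congr (Config 6 (_ :: _)); rewrite /work -/K.
  elim: K {sc Hr rd c} (iota 0 K) (size_iota 0 K) => [|k IHk] [|? l] //= [/IHk->].
  by [].
- by rewrite /applicable rd sc eqxx.
move=> r; rewrite event_machine_rules => /or3P[/mapP[a _ ->]|/tm_rulesP|/tm_rulesP].
- by rewrite /applicable rd sc /= => /eqP[->].
- by move=> [pc [a [v [/main_dom_gt1 pc1 _ _ ->]]]]; rewrite /applicable /= (gtn_eqF (ltnW pc1)).
- by move=> [pc [a [v [/test_dom_gt1 pc1 _ _ ->]]]]; rewrite /applicable /= (gtn_eqF (ltnW pc1)).
Qed.

(** Both tables use address 2; the scanned input symbol, a letter or the blank, decides between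
    them. *)
Lemma main_step pG x t c j : c.1 \in main_dom pG -> 0 < scanned t <= 2 ->
  exists j', step (event_machine pG x) (counter_config (work_registers pG) c t j) =
    counter_config (work_registers pG) (cstep (main_table pG) c) (right t) j'.
Proof.
move=> cD tin; set K := work_registers pG.
have -> : right t = act (Action (scanned t) (scanned t) Right) t by case: t {tin}.
apply: step_counter; first exact: reg_lt_main.
  rewrite event_machine_rules; apply/or3P/Or32/tm_rulesP; exists c.1, (scanned t), (marks K c.2).
  by split=> //; [case: (scanned t) tin => [|[|[]]] | exact: marks_bitvecs].
move=> r; rewrite event_machine_rules => /or3P[/mapP[a _ ->]|/tm_rulesP|/tm_rulesP].
- by rewrite /applicable /= (ltn_eqF (ltnW (main_dom_gt1 cD))).
- move=> [pc [a [v [_ _ /size_bitvecs sv ->]]]]; rewrite applicable_tm_rule //.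
  by move=> /and3P[/eqP-> /eqP-> _]; exists v.
- move=> [pc [a [v [_ a0 /size_bitvecs sv ->]]]]; rewrite applicable_tm_rule //.
  by move: a0 tin; rewrite inE => /eqP-> => tin /and3P[_ /eqP a0]; rewrite -a0 in tin.
Qed.

Lemma test_step pG x t c j : c.1 \in test_dom pG x -> scanned t = 0 ->
  exists j', step (event_machine pG x) (counter_config (work_registers pG) c t j) =
    counter_config (work_registers pG) (cstep (test_table pG x) c) t j'.
Proof.
move=> cD t0; set K := work_registers pG.
have actt : act (Action (scanned t) (scanned t) Stay) t = t by case: t {t0}.
rewrite -[X in counter_config _ (cstep _ _) X]actt.
apply: step_counter; first exact: reg_lt_test.
  rewrite event_machine_rules; apply/or3P/Or33/tm_rulesP; exists c.1, (scanned t), (marks K c.2).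
  by split=> //; [rewrite t0 | exact: marks_bitvecs].
move=> r; rewrite event_machine_rules => /or3P[/mapP[a _ ->]|/tm_rulesP|/tm_rulesP].
- by rewrite /applicable /= (ltn_eqF (ltnW (test_dom_gt1 cD))).
- move=> [pc [a [v [_ a0 /size_bitvecs sv ->]]]]; rewrite applicable_tm_rule //.
  by move=> /and3P[_ /eqP Da _]; rewrite Da t0 in a0.
- move=> [pc [a [v [_ _ /size_bitvecs sv ->]]]]; rewrite applicable_tm_rule //.
  by move=> /and3P[/eqP-> /eqP-> _]; exists v.
Qed.

Lemma test_halted pG x t c j : c.1 \notin test_dom pG x -> c.1 != 0 -> scanned t = 0 ->
  halted (event_machine pG x) (counter_config (work_registers pG) c t j).
Proof.
move=> cD c0 t0; apply/hasPn => r; rewrite event_machine_rules => /or3P[/mapP[a _ ->]|/tm_rulesP|/tm_rulesP].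
- by rewrite /applicable /= eq_sym (negPf c0).
- move=> [pc [a [v [_ a0 /size_bitvecs sv ->]]]]; rewrite applicable_tm_rule //.
  have /negPf-> : a != scanned t by rewrite t0; case: a a0.
  by rewrite andbF.
- move=> [pc [a [v [pcD _ /size_bitvecs sv ->]]]]; rewrite applicable_tm_rule //.
  by case: eqP pcD => //= ->; rewrite (negPf cD).
Qed.

Lemma run_halted M w t T : t <= T -> halted M (run M w t) -> run M w T = run M w t.
Proof.
move=> /subnK <-; elim: (T - t) => // k IHk ht.
rewrite addSn /run iterS -/(run _ _ _) IHk // /step.
by move: ht; rewrite /halted has_filter negbK => /eqP->.
Qed.

(** The time is one start step, one step per input cell, and [t] steps of the test table from the
    address and counters reached by the main run. Outside the test domain and state 0 no rule reads
    a blank input cell, so the machine halts. *)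
Lemma event_machine_accepts pG x w T t c :
  (forall i, (main_run pG i).1 \in main_dom pG) ->
  runs (mem (test_dom pG x)) (test_table pG x) (main_run pG (size w)) t c ->
  c.1 \notin test_dom pG x -> c.1 != 0 -> (size w + t).+1 <= T ->
  accepts_within (event_machine pG x) w T = (c.1 == 1).
Proof.
move=> mainD [Dc testD] cD c0 leT; set M := event_machine pG x.
have Hmain i : i <= size w -> exists j, run M w i.+1 =
    counter_config (work_registers pG) (main_run pG i) (iter i right (input_tape w)) j.
  elim: i => [_|i IHi lt_iw]; first exact: start_step.
  have [j Hj] := IHi (ltnW lt_iw); rewrite /run iterS -/(run M w i.+1) Hj.
  apply: main_step => //; rewrite scanned_input (nth_map false) //.
  by case: nth.
have t0 : scanned (iter (size w) right (input_tape w)) = 0.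
  by rewrite scanned_input nth_default // size_map.
have Htest i : i <= t -> exists j, run M w (size w + i).+1 =
    counter_config (work_registers pG) (iter i (cstep (test_table pG x)) (main_run pG (size w)))
      (iter (size w) right (input_tape w)) j.
  elim: i => [_|i IHi lt_it]; first by rewrite addn0; apply: Hmain.
  have [j Hj] := IHi (ltnW lt_it); rewrite addnS /run iterS -/(run M w _) Hj.
  by apply: test_step => //; apply: testD.
have [j Hj] := Htest t (leqnn t); rewrite Dc in Hj.
have ht : halted M (run M w (size w + t).+1) by rewrite Hj; apply: test_halted.
by rewrite /accepts_within /halts_within (run_halted leT) // ht Hj.
Qed.

(** * Running time of the membership test *)

Lemma exec_move r o s : r != o ->
  exec (move r o) s (2 * s r + 1) (upd (upd s r 0) o (s o + s r)).
Proof.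
move=> ro; move Dn: (s r) => n; elim: n s Dn => [|n IHn] s Dn.
  by rewrite muln0 add0n addn0 -[X in upd s r X]Dn !upd_id; apply: ExLoop0.
have -> : 2 * n.+1 + 1 = 1 + 1 + (2 * n + 1) by lia.
apply: ExLoopS Dn (ExInc _ _) _.
set s1 := upd _ o _; have -> : upd (upd s r 0) o (s o + n.+1) = upd (upd s1 r 0) o (s1 o + n).
  apply: funext => i; rewrite /s1 /upd !eqxx (eq_sym o) (negPf ro).
  by do !case: eqVneq => // ?; subst; rewrite addnS.
by apply: IHn; rewrite /s1 updN // updE.
Qed.

Lemma uphalf_le n : uphalf n <= n.
Proof. by rewrite uphalfE; lia. Qed.

Lemma exec_uphalf s : exec (Loop 1 (Seq (Dec 1) (Inc 3))) s (3 * uphalf (s 1) + 1)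
  (upd (upd s 1 0) 3 (s 3 + uphalf (s 1))).
Proof.
move Dn: (s 1) => n; elim/ltn_ind: n s Dn => -[|n] IHn s Dn.
  by rewrite muln0 add0n addn0 -[X in upd s 1 X]Dn !upd_id; apply: ExLoop0.
set s1 := upd (upd s 1 n.-1) 3 (s 3).+1.
have -> : upd (upd s 1 0) 3 (s 3 + uphalf n.+1) =
          upd (upd s1 1 0) 3 (s1 3 + uphalf n.-1).
  apply: funext => i; rewrite /s1 /upd /=.
  case: eqVneq => _; last by case: eqP.
  by case: (n) => [|m]; rewrite /= addSn addnS ?addn0.
have -> : 3 * uphalf n.+1 + 1 = 1 + (1 + 1) + (3 * uphalf n.-1 + 1).
  by case: (n) => //= m; lia.
apply: ExLoopS Dn (ExSeq (ExDec _ _) (ExInc _ _)) _.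
have -> : upd (upd (upd s 1 n) 1 (upd s 1 n 1).-1) 3
   (upd (upd s 1 n) 1 (upd s 1 n 1).-1 3).+1 = s1.
  by rewrite updE upd_upd /s1 updN.
by apply: IHn => //; lia.
Qed.

(** With [u] the halved value, a round costs 1 for the test, [3 * u + 1] for halving and [2 * u + 1]
    for moving back, and [u] is at most the original value. *)
Lemma exec_halvings s : s 3 = 0 -> exists2 t,
  exec halvings s t (upd (upd s 2 0) 1 (iter (s 2) uphalf (s 1))) &
  t <= s 2 * (5 * s 1 + 3) + 1.
Proof.
move Dx: (s 2) => x; elim: x s Dx => [|x IHx] s Dx s3.
  by exists 1 => //; rewrite -[X in upd s 2 X]Dx !upd_id; apply: ExLoop0.
set s1 := upd s 2 x; set u := uphalf (s 1); set s2 := upd s1 1 u.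
have H : exec (Seq (Loop 1 (Seq (Dec 1) (Inc 3))) (move 3 1)) s1
    (3 * u + 1 + (2 * u + 1)) s2.
  apply: ExSeq (exec_uphalf s1) _; rewrite -/(uphalf (s1 1)).
  have -> : s1 3 + uphalf (s1 1) = u by rewrite /s1 /u !updN // s3.
  have := @exec_move 3 1 (upd (upd s1 1 0) 3 u) isT.
  rewrite updE [upd _ _ _ 1]updN // updE add0n.
  congr exec; apply: funext => i; rewrite /s2 /s1 /upd.
  by do !case: eqVneq => // ?; subst.
have [||t Ht let_] := IHx s2; rewrite ?/s2 ?/s1 //.
exists (1 + (3 * u + 1 + (2 * u + 1)) + t).
  apply: ExLoopS Dx H _; move: Ht; congr exec.
  by rewrite iterSr /s2 /s1 updE; apply: funext => i; rewrite /upd; do !case: eqVneq => // ?; subst.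
have le_u : u <= s 1 by apply: uphalf_le.
have : s2 1 = u by rewrite /s2 updE.
move: let_; rewrite /s2 updE => let_ _.
by apply: (@leq_trans (1 + (3 * u + 1 + (2 * u + 1)) + (x * (5 * u + 3) + 1))); nia.
Qed.

(** A decrement exchanges both the two addresses and the parity, so the claim is proved for both
    starting addresses at once. *)
Lemma runs_parity (P : pred nat) tab a k k' s : P a -> P a.+1 ->
  tab a = IDjz 1 a.+1 k -> tab a.+1 = IDjz 1 a k' ->
  exists s', runs P tab (a, s) (s 1).+1 (if odd (s 1) then k' else k, s').
Proof.
move=> Pa Pa1 ta ta1; move Dv: (s 1) => v.
suff [] : (exists s', runs P tab (a, s) v.+1 (if odd v then k' else k, s')) /\
          (exists s', runs P tab (a.+1, s) v.+1 (if odd v then k else k', s')) by [].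
elim: v s Dv => [|v IHv] s Dv.
  split; exists s.
    by have := @runs1 P tab (a, s) Pa; rewrite /cstep ta /= Dv.
  by have := @runs1 P tab (a.+1, s) Pa1; rewrite /cstep ta1 /= Dv.
have [[s1 H1] [s2 H2]] := IHv (upd s 1 v) (updE _ _ _).
split; [exists s2|exists s1]; rewrite -[v.+2]add1n /=.
  have := @runs1 P tab (a, s) Pa; rewrite /cstep ta /= Dv /= => /runs_trans; apply.
  by case: (odd v) H2.
have := @runs1 P tab (a.+1, s) Pa1; rewrite /cstep ta1 /= Dv /= => /runs_trans; apply.
by case: (odd v) H1.
Qed.

(** The bound adds one step to enter the chain, [x] increments, one jump to the halvings, their
    cost, and the parity check, which takes one step more than the remaining value. *)
Lemma runs_test pG x s : s 2 = 0 -> s 3 = 0 -> exists t s',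
  runs (mem (test_dom pG x)) (test_table pG x) (2, s) t
    (if odd (iter x uphalf (s 1)) then test_addr pG + 8 else 1, s') /\
  t <= (x + x * (5 * s 1 + 3)) + s 1 + 4.
Proof.
move=> s2 s3; set P : pred nat := mem _; set tab := test_table pG x; set b := test_addr pG.
have bE : b = test_addr pG by [].
have b6 : 6 <= b by rewrite /b /test_addr; lia.
have PE pc : P pc = [|| pc == 2, b <= pc < b + 8 | b + 9 <= pc < b + 9 + x.+1].
  by rewrite /P /= in_cons mem_cat !mem_iota.
have tabE pc : tab pc = if pc == 2 then INop (b + 9)
  else if pc < b + 6 then flat halvings b (b + 6) pc
  else if pc == b + 6 then IDjz 1 (b + 7) 1
  else if pc == b + 7 then IDjz 1 (b + 6) (b + 8)
  else if pc < b + 9 + x then IInc 2 pc.+1 else INop b by [].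
have tab_chain i : i < x -> tab (b + 9 + i) = IInc 2 (b + 9 + i).+1.
  by move=> ?; rewrite tabE; do 5?[case: ifP => ? //]; exfalso; lia.
have tab_last : tab (b + 9 + x) = INop b.
  by rewrite tabE; do 5?[case: ifP => ? //]; exfalso; lia.
have tab_even : tab (b + 6) = IDjz 1 (b + 6).+1 1.
  by rewrite tabE -addnS; do 5?[case: ifP => ? //]; exfalso; lia.
have tab_odd : tab (b + 6).+1 = IDjz 1 (b + 6) (b + 8).
  by rewrite tabE -addnS; do 5?[case: ifP => ? //]; exfalso; lia.
have r1 : runs P tab (2, s) 1 (b + 9, s).
  by have := @runs1 P tab (2, s); rewrite /cstep tabE /=; apply; rewrite PE.
have r2 i : i <= x -> runs P tab (b + 9, s) i (b + 9 + i, upd s 2 i).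
  elim: i => [_|i IHi lt_ix]; first by rewrite addn0 -[X in upd s 2 X]s2 upd_id.
  have := @runs1 P tab (b + 9 + i, upd s 2 i); rewrite /cstep tab_chain //=.
  rewrite updE upd_upd -addnS => r; have := runs_trans (IHi (ltnW lt_ix)) (r _).
  by rewrite addn1; apply; rewrite PE; lia.
have r3 : runs P tab (b + 9 + x, upd s 2 x) 1 (b, upd s 2 x).
  have := @runs1 P tab (b + 9 + x, upd s 2 x); rewrite /cstep tab_last; apply.
  by rewrite PE /=; lia.
have [|t et let_] := @exec_halvings (upd s 2 x); first by rewrite updN.
have r4 : runs P tab (b, upd s 2 x) t (b + 6, upd s 1 (iter x uphalf (s 1))).
  have lenh : len halvings = 6 by [].
  have s20 : upd s 2 0 = s by rewrite -[X in upd s 2 X]s2 upd_id.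
  have := exec_flat (tab := tab) (a := b) (k := b + 6) et; rewrite upd_upd updE updN // s20 => r; apply: runsW (r _) => [pc|pc].
    by rewrite PE lenh; lia.
  by rewrite tabE lenh => ?; rewrite ifF ?ifT //; lia.
have [||||s' r5] := @runs_parity P tab (b + 6) 1 (b + 8) (upd s 1 (iter x uphalf (s 1))).
- by rewrite PE; lia.
- by rewrite PE; lia.
- exact: tab_even.
- exact: tab_odd.
rewrite updE in r5; exists (1 + (x + (1 + (t + (iter x uphalf (s 1)).+1)))), s'; split.
  exact: runs_trans r1 (runs_trans (r2 x (leqnn x)) (runs_trans r3 (runs_trans r4 r5))).
have : iter x uphalf (s 1) <= s 1.
  by elim: (x) => //= k IHk; apply: leq_trans (uphalf_le _) IHk.
move: let_; rewrite updE updN //; lia.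
Qed.

(** * The language of the event machine *)

Definition event_state j v := upd (upd (fun=> 0) 0 j) 1 v.

Lemma main_run_events pG G :
  (forall j, executes pG (event_state j 0) (event_state j (G j))) ->
  exists tau : nat -> nat, [/\ forall j, tau j < tau j.+1,
    forall j, main_run pG (tau j) = (2, event_state j (G j)),
    forall i, (main_run pG i).1 \in main_dom pG &
    forall i, (main_run pG i).1 = 2 -> exists j, i = tau j].
Proof.
move=> HG; set tab := main_table pG.
(* Address 2 is excluded, so a run within [P] gives no signal before its end. *)
pose P pc := 2 < pc < test_addr pG.
have tabE pc : tab pc = if pc == 2 then INop 3 else if pc < 6 then flat cleanup 3 6 pc else flat pG 6 2 pc by [].
have rG j : exists t, runs P tab (6, event_state j 0) t (2, event_state j (G j)).
  have [t et] := HG j; exists t.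
  have := exec_flat (tab := tab) (a := 6) (k := 2) et.
  move=> r; apply: runsW (r _) => [pc|pc]; first by rewrite /P /test_addr; lia.
  by move=> ?; rewrite tabE !ifF //; lia.
have rC j v : exists t, runs P tab (3, event_state j v) t (6, event_state j.+1 0).
  have [t et] : executes cleanup (event_state j v) (event_state j.+1 0).
    have := executes_Seq (executes_clear 1 _) (executes_Inc 0 _) => /(_ (event_state j v)); congr executes.
    by apply: funext => i; rewrite /event_state /upd; do !case: eqVneq => // ?; subst.
  exists t; have := exec_flat (tab := tab) (a := 3) (k := 6) et.
  move=> r; apply: runsW (r _) => [pc|pc]; first by rewrite /P /test_addr -[len cleanup]/3; lia.
  by rewrite -[len cleanup]/3 => ?; rewrite tabE ifF ?ifT //; lia.
have /choice[d Hd] : forall j, exists t, runs P tab (3, event_state j (G j)) t (2, event_state j.+1 (G j.+1)).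
  move=> j; have [t rt] := rC j (G j); have [t' rt'] := rG j.+1.
  by exists (t + t'); apply: runs_trans rt rt'.
have [t0 [E0 P0]] := rG 0.
have ev0 : event_state 0 0 = fun=> 0.
  by apply: funext => i; rewrite /event_state /upd; do !case: eqP.
rewrite ev0 in E0 P0.
(* [d j] is counted from address 3; the additional step is the jump there from address 2. *)
pose tau := nat_rect (fun=> nat) t0 (fun j t => t + (d j).+1).
have tau0 : tau 0 = t0 by [].
have tauS j : tau j.+1 = tau j + (d j).+1 by [].
have run_tau j : main_run pG (tau j) = (2, event_state j (G j)).
  elim: j => [|j IHj] //; rewrite tauS addnC /main_run iterD -/(main_run pG (tau j)) IHj iterSr.
  by case: (Hd j).
have between j i : tau j < i < tau j.+1 -> P (main_run pG i).1.
  rewrite tauS => /andP[lt_i lt_i']; rewrite -(subnK lt_i) addnS -addSn /main_run iterD.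
  rewrite -/(main_run pG (tau j)) run_tau iterSr; apply: (Hd j).2; lia.
have locate i : t0 <= i -> exists j, tau j <= i < tau j.+1.
  elim: i => [|i IHi] lei.
    by exists 0; rewrite tauS tau0; lia.
  case: (ltnP i t0) => [lt_i|/IHi[j Hj]]; first by exists 0; rewrite tauS tau0; lia.
  case: (ltnP i.+1 (tau j.+1)) => [lt_i|ge_i]; first by exists j; lia.
  by exists j.+1; rewrite (tauS j.+1); lia.
have inP i : P (main_run pG i).1 \/ exists j, i = tau j.
  case: (ltnP i t0) => [/P0|/locate[j]]; first by left.
  rewrite leq_eqVlt => /andP[/predU1P[<-|lt_i] lt_i']; first by right; exists j.
  by left; apply: (between j); rewrite lt_i.
exists tau; split=> // [j|i|i].
- by rewrite tauS; lia.
- case: (inP i) => [|[j ->]]; last by rewrite run_tau mem_iota /=; lia.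
  by rewrite /P /test_addr mem_iota; lia.
- by case: (inP i) => // + Ei; rewrite Ei.
Qed.

Lemma event_machine_lang pG G :
  (forall j, executes pG (event_state j 0) (event_state j (G j))) ->
  exists2 tau : nat -> nat, (forall j, tau j < tau j.+1) &
    forall x w, clocked_lang (event_machine pG x) (5 * x.+1) w <->
      exists2 j, size w = tau j & ~~ odd (iter x uphalf (G j)).
Proof.
move=> HG; have [tau [ltau run_tau domP only_tau]] := main_run_events HG.
exists tau => // x w; rewrite /clocked_lang /=.
have tau_inj : injective tau by exact: incn_inj (leq_mono (homo_ltn ltn_trans ltau)).
set T := quad_bound _ _; set n := size w.
(* The total is at most 5xn + 4x + 2n + 5 steps, which is below 5(x + 1)(n^2 + 1) because
   [n <= n ^ 2]. *)
have leT t : t <= (x + x * (5 * n + 3)) + n + 4 -> (n + t).+1 <= T.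
  rewrite /T /quad_bound -/n => let_.
  have : n <= n ^ 2 by case: (n) => // k; rewrite expnS leq_pmulr.
  move: (n ^ 2) => m; nia.
case: (eqVneq (main_run pG n).1 2) => [n2|n2].
  have [j Dn] := only_tau _ n2; have Dc := run_tau j; rewrite -Dn in Dc.
  have [t [s' [rt let_]]] := @runs_test pG x (event_state j (G j)) erefl erefl.
  have Gn : G j <= n.
    have := iter_cstep_le (main_table pG) (6, fun=> 0) n 1.
    by rewrite -/(main_run pG n) Dc.
  rewrite -Dc in rt; rewrite (event_machine_accepts domP rt) /=.
  - split=> [|[i Di]]; last by rewrite Di in Dn; rewrite (tau_inj _ _ Dn) => /negPf->.
    by case: (boolP (odd _)) => // odd_ _; exists j.
  - case: ifP => _; rewrite in_cons mem_cat !mem_iota /test_addr; lia.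
  - by case: ifP => _ //; rewrite /test_addr; lia.
  apply: leT; apply: leq_trans let_ _.
  by rewrite !leq_add ?leq_mul ?leq_add ?leq_mul.
(* No event is completed at time [n]: the test table has no rule at the address reached, so the
   machine halts at once and rejects. *)
have Dn := domP n; have H := main_dom_gt1 Dn.
rewrite (event_machine_accepts (t := 0) domP (runs0 _ _ _)).
- split=> [/eqP E|[j Dj _]]; first by rewrite E in H.
  by case/eqP: n2; rewrite -/n Dj run_tau.
- rewrite mem_iota in Dn; rewrite -/n in_cons mem_cat !mem_iota (negPf n2) /test_addr; lia.
- by rewrite -/n; lia.
- by apply: leT.
Qed.

(** * Events *)

(** Prefixing a bit turns [m] into [2m] or [2m - 1]; rounding up the half recovers [m] in both
    cases, and evenness shows the bit. The final 1 is odd and fixed by [uphalf], so all further bits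
    read as false. *)
Definition encode_bits : seq bool -> nat :=
  foldr (fun b m => if b then m + m else (m + m).-1) 1.

Lemma odd_encode_bits bs x : ~~ odd (iter x uphalf (encode_bits bs)) = nth false bs x.
Proof.
have gt0 s : 0 < encode_bits s by elim: s => //= -[] s; lia.
elim: bs x => [|b bs IHbs] x /=.
  by rewrite nth_nil; elim: x => // x; rewrite iterSr.
have : uphalf (if b then encode_bits bs + encode_bits bs else (encode_bits bs + encode_bits bs).-1)
    = encode_bits bs.
  by case: b (gt0 bs); case: (encode_bits bs) => // m _; rewrite addnn ?uphalf_double // doubleS /= doubleK.
case: x => [|x]; last by rewrite iterSr => ->; apply: IHbs.
by move=> _ /=; case: b (gt0 bs); case: (encode_bits bs) => // m _; rewrite addnn ?doubleS /= odd_double.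
Qed.

Definition alive (r : nat -> nat -> nat -> nat -> bool) n u v s :=
  all (fun t => r u v s t) (iota 0 n).

(* Below [k], there are only finitely many times at which a candidate witness
   is refuted; after the last of them the living witnesses are genuine. *)
Definition active (r : nat -> nat -> nat -> nat -> bool) n k := (n == 0) ||
  has (fun u => has (fun v => has (fun s =>
    alive r n.-1 u v s && ~~ r u v s n.-1) (iota 0 k)) (iota 0 k)) (iota 0 k).

Definition up_closed (r : nat -> nat -> nat -> nat -> bool) n (bs : seq bool) :=
  let k := iota 0 (size bs) in
  all (fun u => all (fun v => all (fun s =>
    nth false bs u && alive r n u v s ==> nth false bs v) k) k) k.

Definition event_time j := head 0 (CodeSeq.decode j).
Definition event_bits j := map odd (behead (CodeSeq.decode j)).
(** [j] codes the list of the time followed by the bits of the set, whose number is [k]. Requiring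
    entries at most 1 leaves only one code per event, hence finitely many for each time and [k]. *)
Definition event_valid (r : nat -> nat -> nat -> nat -> bool) j :=
  [&& all (fun b => b <= 1) (behead (CodeSeq.decode j)),
      active r (event_time j) (size (event_bits j))
    & up_closed r (event_time j) (event_bits j)].
Definition in_event (r : nat -> nat -> nat -> nat -> bool) x j := event_valid r j && nth false (event_bits j) x.
(** An invalid number gets the code 1 of the empty list of bits, so it belongs to no [x]. *)
Definition event_code (r : nat -> nat -> nat -> nat -> bool) j := if event_valid r j then encode_bits (event_bits j) else 1.

Lemma in_eventE (r : nat -> nat -> nat -> nat -> bool) x j : in_event r x j = ~~ odd (iter x uphalf (event_code r j)).
Proof.
rewrite /in_event /event_code; case: ifP => _; first by rewrite odd_encode_bits.
by rewrite -[1]/(encode_bits [::]) odd_encode_bits nth_nil.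
Qed.

Lemma aliveP (r : nat -> nat -> nat -> nat -> bool) n u v s : reflect (forall t, t < n -> r u v s t) (alive r n u v s).
Proof.
apply: (iffP allP) => H t; first by move=> tn; apply: H; rewrite mem_iota.
by rewrite mem_iota => tn; apply: H.
Qed.

Lemma activeP (r : nat -> nat -> nat -> nat -> bool) n k : reflect
  (n = 0 \/ exists u v s, [/\ u < k, v < k, s < k & alive r n.-1 u v s && ~~ r u v s n.-1])
  (active r n k).
Proof.
apply: (iffP orP) => -[/eqP|]; try by left.
  move=> /hasP[u uk /hasP[v vk /hasP[s sk H]]]; right; exists u, v, s.
  by move: uk vk sk; rewrite !mem_iota.
move=> [u [v [s [uk vk sk H]]]]; right; apply/hasP; exists u; rewrite ?mem_iota //.
by apply/hasP; exists v; rewrite ?mem_iota //; apply/hasP; exists s; rewrite ?mem_iota.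
Qed.

Lemma up_closedP (r : nat -> nat -> nat -> nat -> bool) n bs : reflect
  (forall u v s, u < size bs -> v < size bs -> s < size bs ->
     nth false bs u -> alive r n u v s -> nth false bs v)
  (up_closed r n bs).
Proof.
apply: (iffP allP) => H.
  move=> u v s uk vk sk bu ar; have := H u; rewrite mem_iota => /(_ uk) /allP H1.
  have := H1 v; rewrite mem_iota => /(_ vk) /allP H2.
  by have := H2 s; rewrite mem_iota => /(_ sk); rewrite bu ar.
move=> u; rewrite mem_iota => uk; apply/allP => v; rewrite mem_iota => vk.
apply/allP => s; rewrite mem_iota => sk; apply/implyP => /andP[].
exact: H.
Qed.

Lemma bounded_family (P : nat -> nat -> Prop) k :
  (forall u, exists N, forall n, P u n -> n <= N) ->
  exists N, forall u n, u < k -> P u n -> n <= N.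
Proof.
move=> H; elim: k => [|k [N HN]]; first by exists 0.
have [N' HN'] := H k; exists (maxn N N') => u n; rewrite ltnS leq_eqVlt leq_max.
by move=> /predU1P[->|uk] Pn; rewrite ?(HN' _ Pn) ?orbT // (HN u).
Qed.

(** If [t] refutes a witness, the witness is no longer alive after [t], so it makes no time beyond
    [t.+1] active. Below [k] there are finitely many triples. *)
Lemma active_bounded (r : nat -> nat -> nat -> nat -> bool) k : exists N, forall n, active r n k -> n <= N.
Proof.
pose P u v s n := alive r n.-1 u v s && ~~ r u v s n.-1.
have H u v s : exists N, forall n, P u v s n -> n <= N.
  case: (pselect (exists t, ~~ r u v s t)) => [[t rt]|nt]; last first.
    by exists 0 => n /andP[_ rn]; case: nt; exists n.-1.
  exists t.+1 => n /andP[/aliveP ar _]; rewrite leqNgt; apply/negP => lt_n.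
  by move/negP: rt; apply; apply: ar; lia.
pose P1 u v n := exists s, s < k /\ P u v s n.
have H1 u v : exists N, forall n, P1 u v n -> n <= N.
  by have [N HN] := bounded_family k (H u v); exists N => n [s [sk]]; apply: HN.
pose P2 u n := exists v, v < k /\ P1 u v n.
have H2 u : exists N, forall n, P2 u n -> n <= N.
  by have [N HN] := bounded_family k (H1 u); exists N => n [s [sk]]; apply: HN.
have [N HN] := bounded_family k H2; exists N => n /activeP[->//|[u [v [s [uk vk sk Pn]]]]].
by apply: HN uk _; exists v; split=> //; exists s.
Qed.

Lemma code_bounded m k : exists N, forall s, all (fun i => i <= m) s -> size s <= k ->
  CodeSeq.code s <= N.
Proof.
elim: k => [|k [N HN]]; first by exists 0 => -[].
exists (2 ^ m * N.*2.+1) => -[//|i s] /= /andP[im sm] sk.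
by rewrite leq_mul ?leq_pexp2l // ltnS leq_double HN.
Qed.

Lemma event_separates (r : nat -> nat -> nat -> nat -> bool) (Q : nat -> nat -> Prop) :
  PreOrder Q -> (forall x y, Q x y <-> exists s, forall t, r x y s t) ->
  forall x y, Q x y <-> exists N, forall j, in_event r x j -> ~~ in_event r y j -> j <= N.
Proof.
move=> [Qrefl Qtrans] HQ x y; split=> [/HQ[s rs]|[N HN]].
  pose k := (maxn y s).+1.
  have [N HN] : exists N, forall n k', k' < k -> active r n k' -> n <= N.
    have [N HN] := bounded_family k (active_bounded r).
    by exists N => n k'; apply: HN.
  (* The list coded by [j] will have head at most [N], other entries at most 1, and length at most
     [k], one more than the number of bits. *)
  have [B HB] := code_bounded (maxn N 1) k.
  exists B => j; rewrite /in_event => /andP[vj xj]; rewrite vj /= => yj.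
  case/and3P: vj => bits act /up_closedP cl.
  (* Otherwise [y] and [s] lie below the size, and so does [x] since its bit is set; closure under
     the genuine witness [s] would then set the bit of [y]. *)
  have sk : size (event_bits j) < k.
    rewrite ltnNge; apply/negP => le_k; move/negP: yj; apply.
    have xlt : x < size (event_bits j).
      by rewrite ltnNge; apply: contraL xj => ?; rewrite nth_default.
    by apply: (cl x y s) => //; [lia..|apply/aliveP].
  rewrite -[j]CodeSeq.decodeK; apply: HB.
    have le_n := HN _ _ sk act; move: bits; rewrite /event_time in le_n.
    case: (CodeSeq.decode j) le_n => //= n l le_n /allP bits; rewrite leq_max le_n /=.
    by apply/allP => i /bits; rewrite leq_max orbC => ->.
  by move: sk; rewrite /event_bits size_map size_behead; lia.
apply: contrapT => nQ.
(* Exceeding [x] and [y] gives them bits; exceeding [N] will make the code of the event, which is at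
   least its length, exceed [N]. *)
pose k := (maxn (maxn x y) N).+1.
have ex_act : exists n, active r n k by exists 0.
have [M HM] := active_bounded r k.
have [n an n_max] := ex_maxnP ex_act HM.
(* If a witness alive at [n] failed later, its first failure [t0] would make [t0.+1] an active time
   beyond the last one. *)
have alive_Q u v s : u < k -> v < k -> s < k -> alive r n u v s -> Q u v.
  move=> uk vk sk /aliveP ar; apply/HQ; exists s => t; apply: contrapT => /negP rt.
  have [t0 rt0 t0_min] := ex_minnP (ex_intro (fun t => ~~ r u v s t) t rt).
  have t0n : n <= t0 by rewrite leqNgt; apply: contra rt0 => /ar.
  have : active r t0.+1 k.
    apply/activeP; right; exists u, v, s; split=> //=; rewrite rt0 andbT.
    by apply/aliveP => i; rewrite ltnNge; apply: contraR => /t0_min.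
  by move=> /n_max; rewrite ltnNge t0n.
(* The [Q]-cone above [x], formed classically; transitivity and [alive_Q] make it closed. *)
pose bs := [seq `[< Q x v >] | v <- iota 0 k].
pose j := CodeSeq.code (n :: map nat_of_bool bs).
have Dn : event_time j = n by rewrite /event_time CodeSeq.codeK.
have Db : event_bits j = bs.
  by rewrite /event_bits CodeSeq.codeK; apply: mapK => b; apply: oddb.
have szb : size bs = k by rewrite size_map size_iota.
have nthb v : v < k -> nth false bs v = `[< Q x v >].
  by move=> vk; rewrite (nth_map 0) ?size_iota // nth_iota.
have vj : event_valid r j.
  apply/and3P; rewrite Dn Db szb; split=> //.
    rewrite CodeSeq.codeK.
    have bits l : all (fun b => b <= 1) (map nat_of_bool l) by elim: l => //= -[].
    exact: bits.
  apply/up_closedP => u v s; rewrite szb => uk vk sk; rewrite !nthb // => /asboolP xu uv.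
  by apply/asboolP; apply: Qtrans xu (alive_Q _ _ _ uk vk sk uv).
have xk : x < k by rewrite /k; lia.
have yk : y < k by rewrite /k; lia.
have := HN j; rewrite /in_event vj Db !nthb //= asboolT; last exact: Qrefl.
rewrite asboolF // => /(_ isT isT); apply/negP; rewrite -ltnNge.
apply: leq_trans (size_code _).
have size_cons l : size (n :: l) = (size l).+1 by [].
by rewrite size_cons size_map szb /k; lia.
Qed.

Lemma cmp_encode_bits (A : encType) (f : A -> seq bool) :
  cmp f -> cmp (fun x => encode_bits (f x)).
Proof.
move=> cf.
apply: (@cmp_foldr _ _ _ f (fun=> 1) (fun (b : bool) m _ => if b then m + m else (m + m).-1) cf (cmp_const _ _)).
have cm : cmp (fun p : (bool * nat) * A => p.1.2 + p.1.2) by apply: cmp_addn; cmp_vars.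
by apply: cmp_if cm (cmp_predn cm); cmp_vars.
Qed.

(** Each nested bounded quantifier receives the outer variables and [j] packed in pairs, the
    innermost variable first. *)
Lemma cmp_event_code (r : nat -> nat -> nat -> nat -> bool) :
  cmp (fun p : nat * (nat * (nat * nat)) => r p.1 p.2.1 p.2.2.1 p.2.2.2) ->
  cmp (event_code r).
Proof.
move=> cr.
have c_r (A : encType) (u v s t : A -> nat) : cmp u -> cmp v -> cmp s -> cmp t ->
    cmp (fun x => r (u x) (v x) (s x) (t x)).
  move=> cu cv cs ct.
  exact: (@cmp_app _ _ _ (fun p : nat * (nat * (nat * nat)) => r p.1 p.2.1 p.2.2.1 p.2.2.2)
    (fun x => (u x, (v x, (s x, t x)))) cr (cmp_pair cu (cmp_pair cv (cmp_pair cs ct)))).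
have c_alive (A : encType) (n u v s : A -> nat) : cmp n -> cmp u -> cmp v -> cmp s ->
    cmp (fun x => alive r (n x) (u x) (v x) (s x)).
  move=> cn cu cv cs.
  apply: (@cmp_all _ _ _ (fun t x => r (u x) (v x) (s x) t) (cmp_iota (cmp_const _ 0) cn)).
  by apply: c_r; [apply: (cmp_app cu)|apply: (cmp_app cv)|apply: (cmp_app cs)|]; cmp_vars.
have c_dec : cmp (fun j => CodeSeq.decode j) by apply: cmp_decode; cmp_vars.
have c_time : cmp event_time by apply: cmp_head.
have c_bits : cmp event_bits.
  apply: (@cmp_map _ _ _ _ (fun n _ => odd n) (cmp_behead c_dec)).
  by apply: cmp_odd; cmp_vars.
have c_range : cmp (fun j => iota 0 (size (event_bits j))).
  exact: cmp_iota (cmp_const _ _) (cmp_size c_bits).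
have c_valid : cmp (event_valid r).
  apply: cmp_andb; last apply: cmp_andb.
  - apply: (@cmp_all _ _ _ (fun b _ => b <= 1) (cmp_behead c_dec)).
    by apply: cmp_leq (cmp_const _ _); cmp_vars.
  - apply: cmp_orb; first exact: cmp_eq0.
    apply: (@cmp_has _ _ _ (fun u j => has (fun v => has (fun s =>
      alive r (event_time j).-1 u v s && ~~ r u v s (event_time j).-1)
        (iota 0 (size (event_bits j)))) (iota 0 (size (event_bits j)))) c_range).
    apply: (@cmp_has _ _ _ (fun v p => has (fun s =>
      alive r (event_time p.2).-1 p.1 v s && ~~ r p.1 v s (event_time p.2).-1)
        (iota 0 (size (event_bits p.2))))); first by apply: (cmp_app c_range); cmp_vars.
    apply: (@cmp_has _ _ _ (fun s q =>
      alive r (event_time q.2.2).-1 q.2.1 q.1 s && ~~ r q.2.1 q.1 s (event_time q.2.2).-1));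
      first by apply: (cmp_app c_range); cmp_vars.
    have ct : cmp (fun q : nat * (nat * (nat * nat)) => (event_time q.2.2.2).-1).
      by apply: cmp_predn; apply: (cmp_app c_time); cmp_vars.
    by apply: cmp_andb; [apply: c_alive ct _ _ _|apply: cmp_negb; apply: c_r _ _ _ ct]; cmp_vars.
  - apply: (@cmp_all _ _ _ (fun u j => all (fun v => all (fun s =>
      nth false (event_bits j) u && alive r (event_time j) u v s ==> nth false (event_bits j) v)
        (iota 0 (size (event_bits j)))) (iota 0 (size (event_bits j)))) c_range).
    apply: (@cmp_all _ _ _ (fun v p => all (fun s =>
      nth false (event_bits p.2) p.1 && alive r (event_time p.2) p.1 v s ==> nth false (event_bits p.2) v)
        (iota 0 (size (event_bits p.2))))); first by apply: (cmp_app c_range); cmp_vars.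
    apply: (@cmp_all _ _ _ (fun s q =>
      nth false (event_bits q.2.2) q.2.1 && alive r (event_time q.2.2) q.2.1 q.1 s ==>
        nth false (event_bits q.2.2) q.1)); first by apply: (cmp_app c_range); cmp_vars.
    have ct : cmp (fun q : nat * (nat * (nat * nat)) => event_time q.2.2.2).
      by apply: (cmp_app c_time); cmp_vars.
    have cb : cmp (fun q : nat * (nat * (nat * nat)) => event_bits q.2.2.2).
      by apply: (cmp_app c_bits); cmp_vars.
    apply: cmp_implb; last by apply: cmp_nth _ cb; cmp_vars.
    by apply: cmp_andb; [apply: cmp_nth _ cb|apply: c_alive ct _ _ _]; cmp_vars.
apply: cmp_if c_valid _ (cmp_const _ _).
exact: cmp_encode_bits.
Qed.

(** * Completeness *)

Lemma test_domE pG x : test_dom pG x =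
  (2 :: iota (test_addr pG) 8) ++ (iota (test_addr pG + 9) x ++ [:: test_addr pG + 9 + x]).
Proof. by rewrite /test_dom -[x.+1]addn1 iotaD. Qed.

(** Only the chain of increments and its closing jump vary with [x]; all other rules form constant
    lists, computable for that reason alone. *)
Lemma cmp_event_machine pG : cmp (fun x => event_machine pG x).
Proof.
set K := work_registers pG; set b := test_addr pG.
have tabE x pc : test_table pG x pc = if pc == 2 then INop (b + 9)
  else if pc < b + 6 then flat halvings b (b + 6) pc
  else if pc == b + 6 then IDjz 1 (b + 7) 1
  else if pc == b + 7 then IDjz 1 (b + 6) (b + 8)
  else if pc < b + 9 + x then IInc 2 pc.+1 else INop b by [].
pose P := allpairs pair [:: 0] (bitvecs K).
pose rules_at i pc := [seq tm_rule K pc i p.1 Stay p.2 | p <- P].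
have E x : tm_rules K (test_table pG x) (test_dom pG x) [:: 0] Stay =
    flatten [seq rules_at (test_table pG 0 pc) pc | pc <- 2 :: iota b 8] ++
    (flatten [seq rules_at (IInc 2 pc.+1) pc | pc <- iota (b + 9) x] ++
     rules_at (INop b) (b + 9 + x)).
  rewrite /tm_rules -/P test_domE -/b 2!map_cat 2!flatten_cat.
  congr (_ ++ (_ ++ _)).
  - congr flatten; apply/eq_in_map => pc; rewrite in_cons mem_iota => pcD.
    rewrite /rules_at (_ : test_table pG x pc = test_table pG 0 pc) // !tabE.
    by do 4?[case: ifP => // ?]; exfalso; lia.
  - congr flatten; apply/eq_in_map => pc; rewrite mem_iota => pcD.
    rewrite /rules_at (_ : test_table pG x pc = IInc 2 pc.+1) // tabE.
    by do 5?[case: ifP => // ?]; exfalso; lia.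
  - rewrite /flatten /= cats0 /rules_at (_ : test_table pG x _ = INop b) // tabE.
    by do 5?[case: ifP => // ?]; exfalso; lia.
(* When only source and target of the rules depend on [pc], their action lists form a constant. *)
have c_at (i : nat -> instr) (k : nat -> nat) : cmp k ->
    (forall v pc, counter_actions K (i pc) v = counter_actions K (i 0) v) ->
    (forall v pc, next_pc (i pc) v = k pc) ->
    cmp (fun pc => rules_at (i pc) pc).
  move=> ck ai ki.
  have := @cmp_map _ _ _ (fun=> [seq Action p.1 p.1 Stay :: counter_actions K (i 0) p.2 | p <- P])
    (fun acts pc => Rule pc (k pc) acts) (cmp_const _ _).
  move=> H; apply: eq_cmp (H _) => [pc|].
    by rewrite -map_comp; apply: eq_map => p; rewrite /= /tm_rule ai ki.
  by apply: cmp_Rule; [|apply: (cmp_app ck)|]; cmp_vars.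
apply: cmp_Machine (cmp_const _ _) _; apply: cmp_cat (cmp_const _ _) _.
apply: cmp_cat (cmp_const _ _) _; rewrite -/K.
apply: (eq_cmp (fun x => esym (E x))); apply: cmp_cat (cmp_const _ _) _.
apply: cmp_cat.
- apply: cmp_flatten; apply: (@cmp_map _ _ _ _ (fun pc _ => rules_at (IInc 2 pc.+1) pc)).
    by apply: cmp_iota (cmp_const _ _) _; cmp_vars.
  apply: (@cmp_app _ _ _ (fun pc => rules_at (IInc 2 pc.+1) pc)); last by cmp_vars.
  by apply: (@c_at (fun pc => IInc 2 pc.+1) (fun pc => pc.+1)) => //; apply: cmp_S; cmp_vars.
- apply: (@cmp_app _ _ _ (fun pc => rules_at (INop b) pc)).
    by apply: (@c_at (fun=> INop b) (fun=> b)) => //; apply: cmp_const.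
  by apply: cmp_addn (cmp_const _ _) _; cmp_vars.
Qed.

(** The code of a clocked machine is itself an index for it, so the reduction can output this
    code. *)
Lemma decode_clocked_enc (p : nat * machine) : decode_clocked (enc p) = p.
Proof.
have decode_actionK a : decode_action (enc a) = a.
  case: a => r w d; rewrite /decode_action.
  have -> : enc (Action r w d) = CodeSeq.code [:: r; w; enc d] by [].
  by rewrite CodeSeq.codeK; case: d.
have decode_ruleK r : decode_rule (enc r) = r.
  case: r => a c s; rewrite /decode_rule.
  have -> : enc (Rule a c s) = CodeSeq.code [:: a, c & map (@enc _) s] by [].
  rewrite CodeSeq.codeK /= drop0.
  by rewrite mapK.
case: p => c [K rs]; rewrite /decode_clocked.
have -> : enc (c, Machine K rs) = CodeSeq.code [:: c, K & map (@enc _) rs] by [].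
by rewrite CodeSeq.codeK /= drop0 mapK.
Qed.

Theorem theorem4p9 : Sigma02_complete_preorder quad_almost_incl.
Proof.
split; [exact: PreOrder_quad_almost_incl | exact: Sigma02_quad_almost_incl |].
move=> Q preQ [R cR QR].
pose r u v s t := R [tuple u; v; s; t].
have [c Hc] : computable1 (event_code r).
  by apply/cmp_computable1/cmp_event_code; apply: cmp_tuple4.
(* Register 0 holds the argument [j], register 1 the result, and scratch starts at 2. *)
have HG j : executes (compile c [:: 0] 1 2) (event_state j 0) (event_state j (event_code r j)).
  have Hj := Hc [tuple j].
  have := @executes_compile _ c _ _ [:: 0] 1 2 (event_state j 0) Hj.
  rewrite /event_state upd_upd; apply=> //.
  by move=> i i2; rewrite /upd; case: eqP i2 => [->|_] //; case: eqP => [->|].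
have [tau ltau langE] := event_machine_lang HG.
set M := event_machine _ in langE.
pose f x := enc (5 * x.+1, M x).
have cf : computable1 f.
  have [g cg gf] : cmp (fun x => (5 * x.+1, M x)).
    apply: cmp_pair (cmp_event_machine _).
    by apply: cmp_muln (cmp_const _ _) _; apply: cmp_S; cmp_vars.
  by apply: eq_computable cg => xs; rewrite -gf.
have langfE x w : quad_lang (f x) w <-> exists2 j, size w = tau j & in_event r x j.
  rewrite /quad_lang decode_clocked_enc langE.
  by split=> -[j sw xj]; exists j => //; rewrite ?in_eventE // -in_eventE.
have tau_mono := leq_mono (homo_ltn ltn_trans ltau).
exists f => // x y; rewrite (event_separates preQ QR) /quad_almost_incl /almost_subset finite_words.
split=> [[N HN]|[s Hs]].
  exists (tau N) => w [/langfE[j sw xj] yw]; rewrite sw tau_mono; apply: HN xj _.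
  by apply/negP => yj; apply: yw; apply/langfE; exists j.
exists s => j xj yj; apply: leq_trans (_ : tau j <= s).
  (* Strict growth of [tau] gives [j <= tau j]. *)
  by elim: (j) => // k IHk; apply: leq_ltn_trans IHk (ltau k).
(* Any word of length [tau j] serves as the element of the difference. *)
rewrite -(size_nseq (tau j) true); apply: Hs; split.
  by apply/langfE; exists j; rewrite // size_nseq.
move/langfE => [j']; rewrite size_nseq => /(incn_inj tau_mono) <- yj'.
by rewrite yj' in yj.
Qed.
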